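(* Let $n=2k+q$ with $k,q\geq 0$ integers (so $q\equiv n\pmod 2$), and put \[ H_{k,q}=\mathsf P_k\times S_q,\qquad \lambda_{k,q}^{\mathrm{row}}=\mathbf 1\boxtimes\mathrm{sgn}_{S_q},\qquad \lambda_{k,q}^{\mathrm{col}}=(\mathrm{sgn}_{S_{2k}}|_{\mathsf P_k})\boxtimes\mathbf 1 . \] Then $(S_n,H_{k,q},\lambda_{k,q}^{\mathrm{row}})$ and $(S_n,H_{k,q},\lambda_{k,q}^{\mathrm{col}})$ are linear Gelfand triples. If $g_{n,q}=\#\{\lambda\vdash n:o_r(\lambda)=q\}$, then their twisted double-coset algebras are both isomorphic to $\mathbb C^{g_{n,q}}$. Moreover, $(S_{2k}\times S_q,H_{k,q})$ is an ordinary Gelfand pair whose double-coset algebra is isomorphic to $\mathbb C^{p(k)}$. Every inducing term $\mathrm{Ind}_H^{S_4}\lambda$ in the two exceptional $S_4$ models $\{\chi^{(4)}+\chi^{(3,1)}+\chi^{(2,2)},\ \chi^{(2,1,1)}+\chi^{(1^4)}\}$ and its transpose $\{\chi^{(1^4)}+\chi^{(2,1,1)}+\chi^{(2,2)},\ \chi^{(3,1)}+\chi^{(4)}\}$ likewise gives a linear Gelfand triple $(S_4,H,\lambda)$.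
   Context: $\mathsf P_k=C_2\wr S_k\le S_{2k}$ is the stabilizer of the pairing $\{1,2\},\{3,4\},\dots,\{2k-1,2k\}$; $S_{2k}\times S_q\le S_n$ is the Young subgroup on the first $2k$ and last $q$ points. $o_r(\lambda)$ is the number of odd parts of $\lambda$; $p(k)$ is the number of partitions of $k$ ($p(0)=1$); $\chi^\lambda$ is the irreducible character of $S_n$ indexed by $\lambda$. For finite groups $H\le G$ and a linear complex character $\lambda$ of $H$, $(G,H,\lambda)$ is a linear Gelfand triple if $\mathrm{Ind}_H^G\lambda$ is multiplicity-free; if $\lambda=\mathbf 1$ one says $(G,H)$ is a Gelfand pair. The twisted double-coset algebra is $\mathscr A(G,H,\lambda)=e_\lambda\mathbb CGe_\lambda$, $e_\lambda=|H|^{-1}\sum_{h\in H}\lambda(h^{-1})h$ (the double-coset algebra when $\lambda=\mathbf 1$). *)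

(* Defs.v *)
From HB Require Import structures.
From mathcomp Require Import all_boot all_order all_algebra.
From mathcomp Require Import all_fingroup all_solvable all_field all_character.

Set Implicit Arguments.
Unset Strict Implicit.
Unset Printing Implicit Defensive.

Import Order.TTheory GroupScope GRing.Theory Num.Theory.
Local Open Scope ring_scope.

Definition is_intpart (n : nat) (s : seq nat) : bool :=
  [&& sorted geq s, 0%N \notin s & sumn s == n].

Record intpart (n : nat) := IntPart {
  parts :> seq nat;
  partsP : is_intpart n parts
}.

HB.instance Definition _ n := [isSub for @parts n].
HB.instance Definition _ n := [Countable of intpart n by <:].

(* Finiteness: a partition of n is determined by its zero-padded n-tuple. *)
Section IntpartFinite.
Variable n : nat.

Let pad (s : intpart n) : n.-tuple 'I_n.+1 :=
  [tuple inord (nth 0%N s i) | i < n].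
Let unpad (t : n.-tuple 'I_n.+1) : option (intpart n) :=
  insub [seq x <- map val t | x != 0%N].

Fact intpart_padK : pcancel pad unpad.
Proof.
move=> s; rewrite /unpad.
have /and3P[_ s0 /eqP sn] := partsP s.
have size_le (r : seq nat) : 0%N \notin r -> (size r <= sumn r)%N.
  elim: r => //= x r IH; rewrite inE negb_or eq_sym -lt0n => /andP[x0 r0].
  by rewrite -add1n leq_add // IH.
have nth_le (r : seq nat) i : (nth 0%N r i <= sumn r)%N.
  elim: r i => [|x r IH] [|i] //=; first exact: leq_addr.
  exact: leq_trans (IH i) (leq_addl _ _).
have szs : (size s <= n)%N by rewrite (leq_trans (size_le _ s0)) ?sn.
have les i : (nth 0%N s i < n.+1)%N by rewrite ltnS (leq_trans (nth_le _ _)) ?sn.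
suff -> : [seq x <- map val (pad s) | x != 0%N] = s.
  by rewrite insubT ?partsP // => sP; congr Some; apply: val_inj.
have -> : map val (pad s) = parts s ++ nseq (n - size s) 0%N.
  apply: (@eq_from_nth _ 0%N).
    by rewrite size_map size_tuple size_cat size_nseq subnKC.
  move=> i; rewrite size_map size_tuple => lt_in.
  rewrite (nth_map ord0) ?size_tuple //.
  rewrite -[i]/(val (Ordinal lt_in)) -tnth_nth tnth_mktuple /= inordK //.
  rewrite nth_cat nth_nseq if_same.
  by case: ltnP => // /(nth_default _) ->.
rewrite filter_cat.
have /all_filterP -> : all (fun x => x != 0%N) s.
  by apply/allP=> x xs; apply: contraNneq s0 => <-.
have -> : [seq x <- nseq (n - size s) 0%N | x != 0%N] = [::].
  by elim: (n - size s)%N.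
exact: cats0.
Qed.

HB.instance Definition _ : isFinite (intpart n) := PCanIsFinite intpart_padK.
End IntpartFinite.

Definition num_parts (k : nat) : nat := #|{: intpart k}|.

Definition odd_parts (s : seq nat) : nat := count odd s.

Definition num_odd_parts (n q : nat) : nat :=
  #|[set la : intpart n | odd_parts la == q]|.

Definition conj_parts (s : seq nat) : seq nat :=
  mkseq (fun j => count (fun x => (j < x)%N) s) (head 0%N s).

Section SignCharacter.
Variables (T : finType) (G : {group {perm T}}).

Fact sgn_subproof :
  is_class_fun <<G>>%g [ffun s => ((-1) ^+ odd_perm s *+ (s \in G) : algC)].
Proof.
rewrite genGid; apply: intro_class_fun => [x y Gx Gy | x /negbTE-> //].
by rewrite groupJr // odd_permJ.
Qed.

Definition sgn : 'CF(G) := Cfun 0 sgn_subproof.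

End SignCharacter.

(* [reshape_index c i] is the index of the block containing i when 0, 1, 2, ...
   is cut into consecutive blocks of sizes c_0, c_1, ... *)
Definition young_blocks (n : nat) (c : seq nat) : {set {set 'I_n}} :=
  [set [set i : 'I_n | reshape_index c i == j] | j : 'I_(size c)].

Definition young (n : nat) (c : seq nat) : {group 'S_n} :=
  'C(young_blocks n c | 'P^* )%G.

(* chi^la is the unique common irreducible constituent of the trivial character
   induced from the Young subgroup of shape la and the sign character induced
   from the Young subgroup of the conjugate shape (James and Kerber), so that
   chi^(n) is trivial and chi^(1^n) is the sign. *)
Definition chiS (n : nat) (la : intpart n) : 'CF([set: 'S_n]) :=
  'chi_(odflt 0 [pick i |
    (i \in irr_constt ('Ind[[set: 'S_n]] (1 : 'CF(young n la)))) &&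
    (i \in irr_constt ('Ind[[set: 'S_n]] (sgn (young n (conj_parts la)))))]).

Section Gelfand.
Variables (gT : finGroupType) (G H : {group gT}).

Definition multiplicity_free (phi : 'CF(G)) : Prop :=
  forall i : Iirr G, '[phi, 'chi_i] <= 1.

Definition linear_gelfand_triple (lam : 'CF(H)) : Prop :=
  [/\ H \subset G, lam \is a linear_char & multiplicity_free ('Ind[G] lam)].

Definition gelfand_pair : Prop := linear_gelfand_triple 1.

(* The complex group algebra of G is the library's [group_ring], realised inside
   'M_#|G| by the regular representation.  MathComp characters take values in
   algC; the coefficient field is any algebraically closed field C with complex
   conjugation (e.g., the complex numbers, or algC itself), and iota embeds the
   character values in it. *)
Variables (C : numClosedFieldType) (iota : {rmorphism algC -> C}).

Definition twisted_idem (lam : 'CF(H)) : 'M[C]_#|G| :=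
  #|H|%:R^-1 *: \sum_(h in H) iota (lam h^-1%g) *: regular_repr C G h.

(* The subspace e_lam * C[G] * e_lam, with its elements encoded by [mxvec]; its
   identity element is e_lam. *)
Definition twisted_dcalg (lam : 'CF(H)) :=
  (mxvec (twisted_idem lam) * group_ring C G * mxvec (twisted_idem lam))%MS.

(* An algebra isomorphism phi from C^g, the functions 'I_g -> C with pointwise
   operations, onto e_lam * C[G] * e_lam. *)
Definition twisted_dcalg_iso (lam : 'CF(H)) (g : nat) : Prop :=
  exists phi : {linear {ffun 'I_g -> C^o} -> 'M[C]_#|G|},
    [/\ {morph phi : u v / u * v >-> u *m v},
        phi 1 = twisted_idem lam,
        injective phi
      & forall A, (A \in twisted_dcalg lam)%MS <-> exists u, A = phi u].

End Gelfand.

Section Models.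
Variables k q : nat.
Local Notation n := (2 * k + q)%N.

(* The points are 0, ..., n - 1, and the pairs are {0, 1}, {2, 3}, ... *)
Definition first_pts : {set 'I_n} := [set i : 'I_n | (i < 2 * k)%N].
Definition last_pts : {set 'I_n} := [set i : 'I_n | (2 * k <= i)%N].
Definition pairing : {set {set 'I_n}} :=
  [set [set i : 'I_n | i./2 == j] | j : 'I_k].

Definition S_first : {group 'S_n} := (perm.Sym_group first_pts).
Definition S_last : {group 'S_n} := (perm.Sym_group last_pts).
Definition P_first : {group 'S_n} := 'N_S_first(pairing | 'P^* )%G.

Definition youngSS : {group 'S_n} := (S_first <*> S_last)%G.
Definition Hkq : {group 'S_n} := (P_first <*> S_last)%G.

Fact Sym_first_last_cent : S_first \subset 'C(S_last).
Proof.
apply/centsP=> s; rewrite inE => s_on t; rewrite inE => t_on.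
apply: (perm_onC s_on t_on).
by rewrite -setI_eq0; apply/eqP/setP=> i; rewrite !inE ltnNge andNb.
Qed.

Fact Sym_first_last_TI : S_first :&: S_last = 1%g.
Proof.
apply/trivgP/subsetP=> s; rewrite !inE => /andP[/subsetP s1 /subsetP s2].
apply/eqP/permP=> i; rewrite perm1; apply/eqP/negP=> /negP si.
have := s1 i si; have := s2 i si; rewrite !inE => le_i.
by rewrite ltnNge le_i.
Qed.

Fact Hkq_dprod : P_first \x S_last = Hkq.
Proof.
have sP : P_first \subset S_first by exact: subsetIl.
apply: dprodEY; first by rewrite centsC (subset_trans sP) ?Sym_first_last_cent.
by apply/trivgP; rewrite -Sym_first_last_TI setSI.
Qed.

Definition lam_row : 'CF(Hkq) := cfDprod Hkq_dprod 1 (sgn S_last).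
Definition lam_col : 'CF(Hkq) :=
  cfDprod Hkq_dprod ('Res[P_first] (sgn S_first)) 1.

End Models.

Definition chi4 (s : seq nat) (sP : is_intpart 4 s) : 'CF([set: 'S_4]) :=
  chiS (IntPart sP).

Definition S4_model : seq 'CF([set: 'S_4]) :=
  [:: @chi4 [:: 4] isT + @chi4 [:: 3; 1] isT + @chi4 [:: 2; 2] isT;
      @chi4 [:: 2; 1; 1] isT + @chi4 [:: 1; 1; 1; 1] isT].

Definition S4_model_transpose : seq 'CF([set: 'S_4]) :=
  [:: @chi4 [:: 1; 1; 1; 1] isT + @chi4 [:: 2; 1; 1] isT + @chi4 [:: 2; 2] isT;
      @chi4 [:: 3; 1] isT + @chi4 [:: 4] isT].

(* Main.v *)
Require Import Defs.
From HB Require Import structures.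
From mathcomp Require Import all_boot all_order all_algebra.
From mathcomp Require Import all_fingroup all_solvable all_field all_character.
From mathcomp Require Import zify.

(** The index set S_n / H_{k,q} is the conjugacy class of an involution t0
    with q fixed points, since H_{k,q} is the centralizer of t0; so double
    cosets are classes of pairs (s, t) of such involutions. The union of the
    two matchings s and t is a graph whose components are paths and even
    cycles. A character of H with values +-1 is also a character of the
    centralizer of s and of that of t, and it supports the double coset when
    the two agree on the centralizer of the pair. For sgn on the fixed
    points, turning a path with an even number of points around excludes it,
    and a pair all of whose paths have odd size is admissible: it is
    determined by its component sizes, a partition of n with q odd parts,
    and the reflections of the components form an involution exchanging s
    and t. This involution makes every admissible double coset self-inverse,
    so e C[G] e consists of symmetric matrices and is commutative (Gelfand's
    trick). In each irreducible representation e is then an idempotent E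
    with E X E Y E = E Y E X E for all X and Y, hence of rank at most 1,
    which gives multiplicity one and a basis of e C[G] e made of orthogonal
    idempotents. The column character is the row character times sgn, and
    for S_{2k} x S_q the two fixed-point sets coincide, leaving the
    partitions whose odd parts are 1. The exceptional models of S_4 are
    induced from the Young subgroups S_2 x S_2 and S_3 x S_1, and have norm
    at most 3. *)

Set Implicit Arguments.
Unset Strict Implicit.
Unset Printing Implicit Defensive.

Import Order.TTheory GroupScope GRing.Theory Num.Theory.
Local Open Scope ring_scope.

(** * The double-coset criterion *)

(** For matrix units X and Y, the (r, c) entries of the two products give [E r p * (E q u * E v c) =
    E r u * (E v p * E q c)]. With v = p, summing over p produces an entry of [E *m E] on the left
    and the trace on the right. *)
Lemma idem_comm_entries (n : nat) (E : 'M[algC]_n) :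
    E *m E = E ->
    (forall X Y, E *m X *m E *m Y *m E = E *m Y *m E *m X *m E) ->
  forall r c b i, E r c * E b i = \tr E * (E r i * E b c).
Proof.
move=> EE EC r c b i.
have ent X p q : (E *m delta_mx p q *m X) r c = E r p * X q c.
  rewrite -mulmxA mxE (bigD1 p) //= big1 ?addr0 => [|l /negbTE lp].
    rewrite mxE (bigD1 q) //= big1 ?addr0 => [|l /negbTE lq].
      by rewrite mxE !eqxx mul1r.
    by rewrite mxE lq andbF mul0r.
  rewrite mxE big1 ?mulr0 // => l' _.
  by rewrite mxE lp mul0r.
have ent2 p q u v : (E *m delta_mx p q *m E *m delta_mx u v *m E) r c =
    E r p * (E q u * E v c).
  rewrite -!mulmxA !mulmxA -2!mulmxA ent; congr (_ * _).
  rewrite mulmxA mxE (bigD1 v) //= big1 ?addr0 => [|l /negbTE lv].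
    congr (_ * _); rewrite mxE (bigD1 u) //= big1 ?addr0 => [|l /negbTE lu].
      by rewrite mxE !eqxx mulr1.
    by rewrite mxE lu mulr0.
  by rewrite mxE big1 ?mul0r // => l' _; rewrite mxE lv andbF mulr0.
have sw p q u v : E r p * (E q u * E v c) = E r u * (E v p * E q c).
  by rewrite -!ent2 EC.
transitivity (\sum_a E r a * (E b i * E a c)).
  have -> : E r c = \sum_a E r a * E a c by rewrite -{1}EE mxE.
  rewrite mulrC mulr_sumr.
  by apply: eq_bigr => a _; rewrite mulrCA.
under eq_bigr do rewrite sw.
by rewrite -mulr_sumr -mulr_suml mulrCA.
Qed.

(** Writing E as [E *m E], the entry identity gives one trace factor and the sum over the middle
    index another. So E vanishes or its trace is 1 or -1. *)
Lemma idem_comm_trace (n : nat) (E : 'M[algC]_n) :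
    E *m E = E ->
    (forall X Y, E *m X *m E *m Y *m E = E *m Y *m E *m X *m E) ->
  E = (\tr E) ^+ 2 *: E.
Proof.
move=> EE EC; have ent := idem_comm_entries EE EC.
apply/matrixP=> r i; rewrite mxE.
transitivity (\sum_c E r c * E c i); first by rewrite -{1}EE mxE.
rewrite (eq_bigr (fun c => \tr E * E r i * E c c)); last first.
  by move=> c _; rewrite ent mulrA.
by rewrite -mulr_sumr expr2 mulrAC.
Qed.

(** An idempotent of rank one compresses every matrix to a multiple of itself; the scalar is the
    coordinate used in the expansion of [e *m A *m e]. *)
Lemma idem_comm_sandwich (n : nat) (E X : 'M[algC]_n) :
    E *m E = E ->
    (forall X Y, E *m X *m E *m Y *m E = E *m Y *m E *m X *m E) ->
  \tr E = 1 -> E *m X *m E = \tr (X *m E) *: E.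
Proof.
move=> EE EC tE; have ent := idem_comm_entries EE EC.
apply/matrixP=> r c; rewrite [RHS]mxE.
rewrite -mulmxA mxE [\tr _]/mxtrace mulr_suml.
transitivity (\sum_a \sum_b X a b * E b a * E r c).
  apply: eq_bigr => a _; rewrite mxE mulr_sumr; apply: eq_bigr => b _.
  rewrite -mulrA [E b a * _]mulrC (ent r c b a) tE mul1r.
  by rewrite mulrCA.
by apply: eq_bigr => a _; rewrite mxE mulr_suml.
Qed.

Lemma memmxB (m n : nat) (R : 'A[algC]_(m, n)) (A B : 'M_n) :
  (A \in R)%MS -> (B \in R)%MS -> (A - B \in R)%MS.
Proof. by move=> RA RB; rewrite linearB addmx_sub ?eqmx_opp. Qed.

Lemma gring_opZ (gT : finGroupType) (G : {group gT}) n
    (rG : mx_representation algC G n) a A :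
  gring_op rG (a *: A) = a *: gring_op rG A.
Proof. exact: linearZ. Qed.

(** * The projection attached to a linear character and Gelfand's trick *)

Section GelfandCriterion.

Variables (gT : finGroupType) (G H : {group gT}) (lam : 'CF(H)).
Hypotheses (sHG : H \subset G) (Llam : lam \is a linear_char).

(* Locked: unification would otherwise unfold it to a scaled sum. *)
Definition lam_proj n (rG : mx_representation algC G n) : 'M[algC]_n :=
  locked (#|H|%:R^-1 *: \sum_(h in H) lam h^-1%g *: rG h).

Lemma lam_projE n (rG : mx_representation algC G n) :
  lam_proj rG = #|H|%:R^-1 *: \sum_(h in H) lam h^-1%g *: rG h.
Proof. by rewrite /lam_proj -lock. Qed.

Lemma lam_projMl n (rG : mx_representation algC G n) h :
  h \in H -> rG h *m lam_proj rG = lam h *: lam_proj rG.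
Proof.
move=> Hh; have Gh := subsetP sHG h Hh.
rewrite lam_projE -scalemxAr scalerA [lam h * _]mulrC -scalerA; congr (_ *: _).
rewrite mulmx_sumr scaler_sumr [RHS](reindex_inj (mulgI h)) /=.
apply: eq_big => [x | x Hx]; first by rewrite groupMl.
rewrite -scalemxAr repr_mxM ?(subsetP sHG) // scalerA.
by rewrite invMg lin_charM ?groupV // mulrCA -lin_charM ?groupV // mulgV lin_char1 ?mulr1.
Qed.

Lemma lam_projMr n (rG : mx_representation algC G n) h :
  h \in H -> lam_proj rG *m rG h = lam h *: lam_proj rG.
Proof.
move=> Hh; have Gh := subsetP sHG h Hh.
rewrite lam_projE -scalemxAl scalerA [lam h * _]mulrC -scalerA; congr (_ *: _).
rewrite mulmx_suml scaler_sumr [RHS](reindex_inj (mulIg h)) /=.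
apply: eq_big => [x | x Hx]; first by rewrite groupMr.
rewrite -scalemxAl repr_mxM ?(subsetP sHG) // scalerA.
by rewrite -lin_charM ?groupV ?groupM // invMg mulKVg.
Qed.

Lemma lam_proj_idem n (rG : mx_representation algC G n) :
  lam_proj rG *m lam_proj rG = lam_proj rG.
Proof.
rewrite {1}lam_projE -scalemxAl mulmx_suml.
rewrite (eq_bigr (fun _ => lam_proj rG)) => [|h Hh].
  by rewrite sumr_const -scaler_nat scalerA mulVf ?scale1r // pnatr_eq0 -lt0n.
rewrite -scalemxAl lam_projMl // scalerA -lin_charM ?groupV //.
by rewrite mulVg lin_char1 // scale1r.
Qed.

Lemma mulmx_lam_projE n (rG : mx_representation algC G n) m p
    (L : 'M_(m, n)) (R : 'M_(n, p)) :
  L *m lam_proj rG *m R =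
    #|H|%:R^-1 *: \sum_(h in H) lam h^-1%g *: (L *m rG h *m R).
Proof.
rewrite lam_projE -scalemxAr -scalemxAl mulmx_sumr mulmx_suml; congr (_ *: _).
by apply: eq_bigr => h _; rewrite -scalemxAr -scalemxAl.
Qed.

Lemma lam_proj_tr (i : Iirr G) : \tr (lam_proj 'Chi_i) = '['Res[H] 'chi[G]_i, lam].
Proof.
rewrite lam_projE mxtraceZ cfdotE raddf_sum /=; congr (_ * _); apply: eq_bigr => h Hh.
rewrite mxtraceZ lin_charV_conj // mulrC cfResE //.
by rewrite -irrRepr cfunE (subsetP sHG).
Qed.

Lemma gring_op_lam_proj n (rG : mx_representation algC G n) :
  gring_op rG (lam_proj (regular_repr algC G)) = lam_proj rG.
Proof.
rewrite !lam_projE linearZ linear_sum /=; congr (_ *: _); apply: eq_bigr => h Hh.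
by rewrite linearZ /= gring_opG // (subsetP sHG).
Qed.

Lemma lam_proj_mem : (lam_proj (regular_repr algC G) \in group_ring algC G)%MS.
Proof.
rewrite lam_projE linearZ scalemx_sub // linear_sum summx_sub // => h Hh.
by rewrite linearZ scalemx_sub // envelop_mx_id // (subsetP sHG).
Qed.

(** Right translations act by permutation matrices, whose inverses are their transposes. *)
Lemma tr_regular_repr x : x \in G ->
  (regular_repr algC G x)^T = regular_repr algC G x^-1%g.
Proof.
move=> Gx; apply/matrixP=> i j; rewrite !mxE !eqxx /=.
have eqi y (k l : 'I_#|G|) : y \in G ->
    (k == gring_index G (enum_val l * y)) = (enum_val k == enum_val l * y)%g.
  move=> Gy; apply/eqP/eqP => [->|<-]; last by rewrite gring_valK.
  by rewrite gring_indexK ?groupM ?enum_valP.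
rewrite !eqi ?groupV //; congr ((nat_of_bool _)%:R).
by apply/eqP/eqP=> ->; rewrite ?mulgK ?mulgKV.
Qed.

(** The regular character of A times the inverse of x is #|G| times the coefficient of A at x. It is
    also a combination of the irreducible characters, each of which vanishes there. *)
Lemma gring_op_inj A : (A \in group_ring algC G)%MS ->
  (forall i : Iirr G, gring_op 'Chi_i A = 0) -> A = 0.
Proof.
move=> /envelop_mxP[a defA] A0; rewrite defA big1 // => x Gx.
suff /eqP: #|G|%:R * a x = 0.
  by rewrite mulf_eq0 pnatr_eq0 eqn0Ngt cardG_gt0 => /eqP->; rewrite scale0r.
transitivity (cfReg G).[A *m regular_repr algC G x^-1%g]%CF.
  rewrite defA mulmx_suml raddf_sum (bigD1 x) //= -scalemxAl xcfunZr.
  rewrite -repr_mxM ?groupV // mulgV xcfunG // cfRegE eqxx mulrC big1 ?addr0 //.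
  move=> y /andP[Gy /negbTE neq_xy]; rewrite -scalemxAl xcfunZr.
  rewrite -repr_mxM ?groupV // xcfunG ?groupM ?groupV // cfRegE.
  by rewrite -eq_mulgV1 neq_xy mulr0.
rewrite cfReg_sum -xcfun_rE raddf_sum big1 //= => i _.
rewrite xcfunZl -irrRepr xcfun_repr gring_opM ?envelop_mx_id ?groupV //.
by rewrite A0 mul0mx raddf0 mulr0.
Qed.

Hypothesis lam2 : {in H, forall h, lam h ^+ 2 = 1}.

(* The g whose double coset H g H carries a nonzero (H, lam)-biequivariant
   function. *)
Definition lam_adm : {set gT} :=
  [set g in G | [forall h in H, (h ^ g \in H)%g ==> (lam (h ^ g)%g == lam h)]].

Hypothesis lam_adm_inv :
  {in lam_adm, forall g, exists2 h, h \in H & ((g * h) * (g * h) = 1)%g}.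

Local Notation aG := (regular_repr algC G).
Local Notation e := (lam_proj aG).

Lemma lam_real h : h \in H -> lam h^-1%g = lam h.
Proof.
move=> Hh; have lamh0: lam h != 0 by rewrite lin_char_neq0.
apply: (mulfI lamh0); rewrite -lin_charM ?groupV // mulgV lin_char1 //.
by rewrite -expr2 lam2.
Qed.

Lemma tr_lam_proj : e^T = e.
Proof.
rewrite lam_projE linearZ linear_sum /=; congr (_ *: _).
rewrite (reindex_inj invg_inj); apply: eq_big => [h|h]; rewrite groupV // => Hh.
rewrite linearZ /= tr_regular_repr ?groupV ?(subsetP sHG) // invgK.
by rewrite lam_real.
Qed.

(** If x is admissible, its inverse is h x h with h in H, and absorbing both h into e costs
    [lam h ^+ 2 = 1]. If not, some h passes through x with two different scalars, so the product is
    0, and likewise for the transpose. *)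
Lemma tr_lam_sandwich x : x \in G -> (e *m aG x *m e)^T = e *m aG x *m e.
Proof.
move=> Gx; rewrite !trmx_mul tr_lam_proj tr_regular_repr // mulmxA.
have [/lam_adm_inv[h Hh xh1] | xA] := boolP (x \in lam_adm).
  have Gh := subsetP sHG h Hh.
  have -> : (x^-1 = h * x * h)%g.
    by apply: (mulgI x); rewrite mulgV !mulgA -(mulgA (x * h)%g) xh1.
  rewrite !repr_mxM ?groupM // !mulmxA (lam_projMr _ Hh).
  rewrite -[_ *m aG h *m _]mulmxA (lam_projMl _ Hh) -scalemxAr -!scalemxAl.
  by rewrite scalerA -expr2 lam2 // scale1r.
suff B0 y : y \in G -> y \notin lam_adm -> e *m aG y *m e = 0.
  have /(congr1 trmx) := B0 x Gx xA.
  by rewrite !trmx_mul tr_lam_proj tr_regular_repr // mulmxA trmx0 B0.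
move=> {x Gx xA} Gy; rewrite inE Gy => /forall_inPn[h Hh].
rewrite negb_imply => /andP[Hhy /eqP neq].
have Gh := subsetP sHG h Hh; have Ghy := subsetP sHG _ Hhy.
have: lam h *: (e *m aG y *m e) = lam (h ^ y)%g *: (e *m aG y *m e).
  rewrite !scalemxAl -lam_projMr // -[_ *m aG h *m _]mulmxA -repr_mxM //.
  rewrite conjgC repr_mxM // mulmxA -[_ *m aG (h ^ y)%g *m _]mulmxA.
  rewrite lam_projMl // -scalemxAr.
  by rewrite !scalemxAl.
move/eqP; rewrite -subr_eq0 -scalerBl scaler_eq0 subr_eq0.
by case/orP=> [/eqP/esym/neq | /eqP].
Qed.


(** Expanding the middle e writes the product of two symmetric sandwiches as a combination of
    sandwiches, hence as a symmetric matrix; transposing it exchanges the factors. *)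
Lemma lam_sandwich_comm x y : x \in G -> y \in G ->
  e *m aG x *m e *m aG y *m e = e *m aG y *m e *m aG x *m e.
Proof.
move=> Gx Gy; set B := fun z => e *m aG z *m e.
have eB u v : e *m aG u *m e *m aG v *m e = B u *m B v.
  by rewrite /B !mulmxA -[_ *m e *m e]mulmxA lam_proj_idem.
rewrite !eB; have Bsym u v : u \in G -> v \in G -> (B u *m B v)^T = B u *m B v.
  move=> Gu Gv; rewrite -!eB -[_ *m aG v *m e]mulmxA.
  rewrite mulmx_lam_projE linearZ /=; congr (_ *: _).
  rewrite raddf_sum /=; apply: eq_bigr => h Hh; have Gh := subsetP sHG h Hh.
  rewrite linearZ /=; congr (_ *: _).
  by rewrite mulmxA -2!(mulmxA e) -!repr_mxM ?groupM // tr_lam_sandwich ?groupM.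
by rewrite -Bsym // trmx_mul !tr_lam_sandwich.
Qed.

(** By absolute irreducibility the matrices ['Chi_i x] span the full matrix algebra, so bilinearity
    extends the identity from group elements to all X and Y. *)
Lemma lam_proj_irr_comm (i : Iirr G) (E := lam_proj 'Chi_i) X Y :
  E *m X *m E *m Y *m E = E *m Y *m E *m X *m E.
Proof.
have /mx_abs_irrP[_ [a Da]] : mx_absolutely_irreducible 'Chi_i.
  by apply: groupC; apply: socle_irr.
have: {in G &, forall x y,
    E *m 'Chi_i x *m E *m 'Chi_i y *m E = E *m 'Chi_i y *m E *m 'Chi_i x *m E}.
  move=> x y Gx Gy; have := congr1 (gring_op 'Chi_i) (lam_sandwich_comm Gx Gy).
  by rewrite !gring_opM ?envelop_mx_id ?lam_proj_mem // !gring_op_lam_proj !gring_opG.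
clearbody E => EC.
have EE u v : E *m (\sum_(x in G) a x u *: 'Chi_i x) *m E *m
    (\sum_(y in G) a y v *: 'Chi_i y) *m E =
   \sum_(x in G) \sum_(y in G)
      a x u * a y v *: (E *m 'Chi_i x *m E *m 'Chi_i y *m E).
  rewrite exchange_big mulmx_sumr !mulmx_suml; apply: eq_bigr => y _.
  rewrite mulmx_sumr !mulmx_suml; apply: eq_bigr => x _.
  by rewrite -!(scalemxAr, scalemxAl) scalerA mulrC.
rewrite (Da X) (Da Y) !EE exchange_big /=.
apply: eq_bigr => y Gy; apply: eq_bigr => x Gx.
by rewrite mulrC EC.
Qed.

Lemma cfdot_Ind_irr (i : Iirr G) :
  '['Ind[G] lam, 'chi_i] = \tr (lam_proj 'Chi_i).
Proof.
rewrite lam_proj_tr -Frobenius_reciprocity cfdotC conj_natr //.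
by rewrite Cnat_cfdot_char ?cfRes_char ?irr_char ?lin_charW.
Qed.

(** The trace T is a multiplicity, hence nonnegative, and it satisfies T = T^3; only 0 and 1
    remain. *)
Lemma lam_proj_tr01 (i : Iirr G) :
  \tr (lam_proj 'Chi_i) = (i \in irr_constt ('Ind[G] lam))%:R.
Proof.
rewrite irr_consttE cfdot_Ind_irr; set T := \tr _.
have T0 : 0 <= T.
  rewrite /T lam_proj_tr natr_ge0 // Cnat_cfdot_char ?cfRes_char ?irr_char //.
  exact: lin_charW.
have [-> // | nzT] := eqVneq T 0.
have TT : 1 * T = T ^+ 2 * T.
  have ET := idem_comm_trace (lam_proj_idem _) (@lam_proj_irr_comm i).
  by rewrite mul1r -mxtraceZ -ET.
move/(mulIf nzT)/esym/eqP: TT.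
by rewrite sqrf_eq1 => /orP[/eqP // | /eqP T1]; rewrite T1 oppr_ge0 ler10 in T0.
Qed.

Lemma gelfand_triple_crit : linear_gelfand_triple G lam.
Proof.
split=> // i; rewrite cfdot_Ind_irr lam_proj_tr01.
by case: (_ \in _); rewrite ?lexx ?ler01.
Qed.

(** The component of e in the Wedderburn block of i. Those of the constituents of the induced
    character are the orthogonal idempotents that form the basis of the twisted algebra. *)
Definition lam_cid (i : Iirr G) : 'M[algC]_#|G| :=
  locked (Wedderburn_id (socle_of_Iirr i) *m e).

Lemma lam_cid_mem i : (lam_cid i \in group_ring algC G)%MS.
Proof.
rewrite /lam_cid -lock envelop_mxM ?lam_proj_mem //.
by have := Wedderburn_id_mem (socle_of_Iirr i); rewrite genmxE mem_sub_gring => /andP[].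
Qed.

Lemma gring_op_lam_cid i j :
  gring_op 'Chi_j (lam_cid i) = (i == j)%:R *: lam_proj 'Chi_j.
Proof.
rewrite /lam_cid -lock gring_opM ?lam_proj_mem // gring_op_lam_proj.
have [<-|neq] := eqVneq i j.
  by rewrite op_Wedderburn_id_pchar ?algC'G_pchar // mul1mx scale1r.
rewrite scale0r (irr_repr'_op0_pchar (algC'G_pchar G) (j := socle_of_Iirr i)).
- by rewrite mul0mx.
- by rewrite (can_eq socle_of_IirrK).
exact: Wedderburn_id_mem.
Qed.

Lemma lam_proj0 (i : Iirr G) :
  i \notin irr_constt ('Ind[G] lam) -> lam_proj 'Chi_i = 0.
Proof.
move/negbTE=> iI.
rewrite (idem_comm_trace (lam_proj_idem _) (@lam_proj_irr_comm i)).
by rewrite lam_proj_tr01 iI expr0n scale0r.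
Qed.

(** An element of the group ring is determined by its images in the irreducible representations. In
    each of these the left side is a scalar multiple of a rank one idempotent, or 0. *)
Lemma lam_sandwich_span A : (A \in group_ring algC G)%MS ->
  e *m A *m e = \sum_(i in irr_constt ('Ind[G] lam))
     \tr (gring_op 'Chi_i A *m lam_proj 'Chi_i) *: lam_cid i.
Proof.
move=> RA; apply/eqP; rewrite -subr_eq0; apply/eqP/gring_op_inj => [|j].
  apply: memmxB; first by rewrite !envelop_mxM ?lam_proj_mem.
  rewrite linear_sum summx_sub // => i _.
  by rewrite linearZ scalemx_sub // lam_cid_mem.
rewrite linearB /= !gring_opM ?lam_proj_mem // gring_op_lam_proj.
rewrite linear_sum /=; have [jI | jI] := boolP (j \in irr_constt ('Ind[G] lam)).
  rewrite (bigD1 j) //= big1 ?addr0 => [|i /andP[_ /negbTE ij]]; last first.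
    by rewrite gring_opZ gring_op_lam_cid ij scale0r scaler0.
  rewrite gring_opZ gring_op_lam_cid eqxx scale1r.
  rewrite idem_comm_sandwich ?lam_proj_idem ?subrr //; first exact: lam_proj_irr_comm.
  by rewrite lam_proj_tr01 jI.
rewrite (lam_proj0 jI) mulmx0 big1 ?subr0 // => i iI.
by rewrite gring_opZ gring_op_lam_cid (lam_proj0 jI) !scaler0.
Qed.

Lemma lam_cidM i j : lam_cid i *m lam_cid j = (i == j)%:R *: lam_cid j.
Proof.
apply/eqP; rewrite -subr_eq0; apply/eqP/gring_op_inj => [|k].
  apply: memmxB; first by rewrite envelop_mxM ?lam_cid_mem.
  by rewrite linearZ scalemx_sub // lam_cid_mem.
rewrite linearB /= gring_opZ gring_opM ?lam_cid_mem // !gring_op_lam_cid.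
rewrite -scalemxAl -scalemxAr lam_proj_idem !scalerA -!natrM !mulnb.
have [->|ij] := eqVneq i j; first by rewrite andbb subrr.
have [<-|] := eqVneq j k; last by rewrite ?andbF /= ?(mulr0n, scale0r, subrr).
by rewrite (negbTE ij) ?andbF /= ?(mulr0n, scale0r, subrr).
Qed.

Lemma lam_cid_proj i : lam_cid i = e *m lam_cid i *m e.
Proof.
apply/eqP; rewrite -subr_eq0; apply/eqP/gring_op_inj => [|k].
  apply: memmxB; first exact: lam_cid_mem.
  apply: envelop_mxM lam_proj_mem.
  exact: envelop_mxM lam_proj_mem (lam_cid_mem i).
rewrite linearB /= (gring_opM _ (e *m lam_cid i) lam_proj_mem).
rewrite (gring_opM _ e (lam_cid_mem i)).
by rewrite gring_op_lam_cid gring_op_lam_proj -scalemxAr -scalemxAl !lam_proj_idem subrr.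
Qed.

Lemma lam_cid_neq0 i : i \in irr_constt ('Ind[G] lam) -> lam_cid i != 0.
Proof.
move=> iI; apply/eqP=> f0; have := lam_proj_tr01 i; rewrite iI.
have := gring_op_lam_cid i i; rewrite f0 linear0 eqxx scale1r => <-.
by rewrite raddf0 => /esym/eqP; rewrite oner_eq0.
Qed.

(** * Extension of scalars along [iota] and the isomorphism with functions on the constituents *)

Section Scalars.

Variables (C : numClosedFieldType) (iota : {rmorphism algC -> C}).

Lemma twisted_idemE : twisted_idem G iota lam = map_mx iota e.
Proof.
rewrite lam_projE map_mxZ rmorphV ?unitfE ?pnatr_eq0 -?lt0n // rmorph_nat.
congr (_ *: _); rewrite raddf_sum; apply: eq_bigr => h _.
by rewrite /= map_mxZ map_regular_mx.
Qed.

Local Notation K := [set i in irr_constt ('Ind[G] lam)].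
Local Notation g := #|K|.

Definition dcalg_map (u : {ffun 'I_g -> C^o}) : 'M[C]_#|G| :=
  \sum_k (u k : C) *: map_mx iota (lam_cid (enum_val k)).

Lemma dcalg_map_linear : linear dcalg_map.
Proof.
move=> a u v; rewrite /dcalg_map scaler_sumr -big_split /=; apply: eq_bigr => k _.
by rewrite !ffunE scalerDl scalerA.
Qed.

HB.instance Definition _ := GRing.isLinear.Build C {ffun 'I_g -> C^o} 'M[C]_#|G| _
  dcalg_map dcalg_map_linear.

Lemma dcalg_iso : twisted_dcalg_iso G iota lam g.
Proof.
exists dcalg_map; split.
- move=> u v; rewrite /= /dcalg_map mulmx_suml; apply: eq_bigr => k _.
  rewrite mulmx_sumr (bigD1 k) //= big1 ?addr0 => [|l lk].
    by rewrite -scalemxAl -scalemxAr -map_mxM lam_cidM eqxx scale1r scalerA ffunE.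
  rewrite -scalemxAl -scalemxAr -map_mxM lam_cidM (inj_eq enum_val_inj).
  by rewrite eq_sym (negbTE lk) scale0r map_mx0 !scaler0.
(* Expanding [e *m 1 *m e] shows that e is the sum of the basis idempotents: each coefficient is a
   trace equal to 1. *)
- have := lam_sandwich_span (envelop_mx1 _); rewrite mulmx1 lam_proj_idem.
  rewrite twisted_idemE => ->; rewrite raddf_sum /= /dcalg_map.
  rewrite (eq_bigl (fun i => i \in K)) => [|i]; last by rewrite inE.
  rewrite (@big_enum_val _ _ _ _ (pred_of_set K)); apply: eq_bigr => k _; rewrite ffunE scale1r.
  rewrite gring_op1 mul1mx lam_proj_tr01.
  by have := enum_valP k; rewrite inE => ->; rewrite scale1r.
- move=> u v eq_uv; apply/ffunP=> k; apply/eqP; rewrite -subr_eq0.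
  (* Multiplying by the k-th idempotent isolates the k-th coordinate. *)
  have dcalg_mapM w : dcalg_map w *m map_mx iota (lam_cid (enum_val k)) =
      (w k : C) *: map_mx iota (lam_cid (enum_val k)).
    rewrite mulmx_suml (bigD1 k) //= big1 ?addr0 => [|l lk].
      by rewrite -scalemxAl -map_mxM lam_cidM eqxx scale1r.
    rewrite -scalemxAl -map_mxM lam_cidM (inj_eq enum_val_inj).
    by rewrite (negbTE lk) scale0r map_mx0 !scaler0.
  have: (u k - v k : C) *: map_mx iota (lam_cid (enum_val k)) == 0.
    by rewrite scalerBl -!dcalg_mapM [dcalg_map u]eq_uv subrr.
  rewrite scaler_eq0 map_mx_eq0 => /orP[] // f0.
  by have := enum_valP k; rewrite inE => /lam_cid_neq0; rewrite f0.
move=> A; split=> [| [u ->]].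
  (* Elements of a product of matrix spaces are sums of products, so closure of the range under sums
     and scalings reduces the inclusion to the elements [e *m aG x *m e]. *)
  have phiD B D : (exists u, B = dcalg_map u) -> (exists u, D = dcalg_map u) ->
      exists u, B + D = dcalg_map u.
    by move=> [u ->] [v ->]; exists (u + v); rewrite linearD.
  have phiZ a B : (exists u, B = dcalg_map u) -> exists u, a *: B = dcalg_map u.
    by move=> [u ->]; exists (a *: u); rewrite linearZ.
  have phi0 : exists u, 0 = dcalg_map u by exists 0; rewrite linear0.
  case/mulsmxP=> A1 RA1 [A2 RA2 ->].
  apply: (big_ind (fun B => exists u, B = dcalg_map u)) => // i _.
  have /sub_rVP[a Da] := RA2 i.
  have -> : A2 i = a *: map_mx iota e.
    by apply: (can_inj mxvecK); rewrite Da twisted_idemE linearZ.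
  rewrite -scalemxAr; apply: (phiZ _ _); case/mulsmxP: (RA1 i) => B1 RB1 [B2 RB2 ->].
  rewrite mulmx_suml; apply: (big_ind (fun B => exists u, B = dcalg_map u)) => // j _.
  have /sub_rVP[b Db] := RB1 j.
  have -> : B1 j = b *: map_mx iota e.
    by apply: (can_inj mxvecK); rewrite Db twisted_idemE linearZ.
  have /envelop_mxP[c ->] := RB2 j.
  rewrite -!scalemxAl; apply: (phiZ _ _); rewrite mulmx_sumr mulmx_suml.
  apply: (big_ind (fun B => exists u, B = dcalg_map u)) => // x Gx.
  rewrite -!scalemxAr -!scalemxAl; apply: (phiZ _ _).
  have -> : regular_repr C G x = map_mx iota (aG x) by rewrite map_regular_mx.
  rewrite -!map_mxM lam_sandwich_span ?envelop_mx_id //.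
  exists [ffun k => iota (\tr (gring_op 'Chi_(enum_val k) (aG x) *m
                               lam_proj 'Chi_(enum_val k)))].
  rewrite raddf_sum /= (eq_bigl (fun i => i \in K)) => [|l]; last by rewrite inE.
  rewrite (@big_enum_val _ _ _ _ (pred_of_set K)); apply: eq_bigr => k _.
  by rewrite ffunE /= map_mxZ.
(* Conversely each basis idempotent f belongs to the algebra because f = e f e. *)
have RF i : (map_mx iota (lam_cid i) \in twisted_dcalg G iota lam)%MS.
  rewrite lam_cid_proj !map_mxM -twisted_idemE.
  apply: mem_mulsmx; last exact: submx_refl.
  apply: mem_mulsmx; first exact: submx_refl.
  have /envelop_mxP[c ->] := lam_cid_mem i.
  rewrite raddf_sum linear_sum summx_sub // => x Gx.
  by rewrite /= map_mxZ map_regular_mx linearZ scalemx_sub ?envelop_mx_id.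
rewrite /= /dcalg_map linear_sum summx_sub // => k _.
by rewrite linearZ scalemx_sub ?RF.
Qed.

End Scalars.

(** * Counting the constituents by admissible double cosets *)

(** On the intersection of H with its conjugate, h maps to [lam h * lam (h ^ y)], a linear character
    with values 1 and -1. It is trivial exactly for admissible y; otherwise translation by an h0
    with value -1 makes the sum vanish. *)
Lemma lam_adm_sum y : y \in G ->
  \sum_(h in H) lam h * lam (h ^ y)%g =
    (#|(H :&: H :^ y^-1)%g| * (y \in lam_adm))%:R.
Proof.
move=> Gy; rewrite (bigID (mem (H :^ y^-1)%g)) /=.
rewrite [X in _ + X]big1 ?addr0 => [|h /andP[_]]; last first.
  by rewrite mem_conjgV => /cfun0->; rewrite mulr0.
have memD h : h \in (H :&: H :^ y^-1)%g -> (h \in H) /\ (h ^ y \in H)%g.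
  by rewrite inE mem_conjgV => /andP.
rewrite (eq_bigl (fun h => h \in (H :&: H :^ y^-1)%g)) => [|h]; last by rewrite inE.
have [yA | yA] := boolP (y \in lam_adm).
  rewrite muln1 -sum1_card natr_sum; apply: eq_bigr => h /memD[Hh Hhy].
  move: yA; rewrite inE Gy => /forall_inP/(_ h Hh)/implyP/(_ Hhy)/eqP->.
  by rewrite -expr2 lam2.
rewrite muln0; move: yA; rewrite inE Gy => /forall_inPn[h0 Hh0].
rewrite negb_imply => /andP[Hh0y neq].
set S := \sum_(h in _) _.
have memh0 : h0 \in (H :&: H :^ y^-1)%g by rewrite inE Hh0 mem_conjgV.
have : S = lam h0 * lam (h0 ^ y)%g * S.
  rewrite {1}/S (reindex_inj (mulgI h0)) /= mulr_sumr.
  apply: eq_big => [h | h]; rewrite groupMl // => /memD[Hh Hhy].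
  by rewrite conjMg (lin_charM Llam Hh0 Hh) (lin_charM Llam Hh0y Hhy) mulrACA.
move/eqP; rewrite -subr_eq0 -{1}[S]mul1r -mulrBl mulf_eq0 => /orP[|/eqP //].
rewrite subr_eq0 => /eqP e1; case/eqP: neq.
have nz0 : lam h0 != 0 by rewrite lin_char_neq0.
by apply: (mulfI nz0); rewrite -e1 -expr2 lam2.
Qed.

Lemma card_double_coset y :
  (#|((H :* y) * H)%g| * #|(H :&: H :^ y^-1)%g| = #|H| * #|H|)%N.
Proof.
have -> : ((H :* y) * H = y *: (H :^ y * H))%g.
  by rewrite conjsgE !mulgA mulg_set1 mulgV -set1gE mul1g.
by rewrite card_lcoset -(cardJg (H :&: _) y) conjIg conjsgKV -mul_cardG cardJg.
Qed.

Lemma lam_admM h y k : h \in H -> k \in H -> y \in lam_adm ->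
  (h * y * k)%g \in lam_adm.
Proof.
move=> Hh Hk; have Gh := subsetP sHG h Hh; have Gk := subsetP sHG k Hk.
rewrite !inE => /andP[Gy /forall_inP yA]; rewrite !groupM //=.
apply/forall_inP=> h' Hh'; apply/implyP; rewrite !conjgM groupJr // => Hhy.
by rewrite cfunJ // (eqP (implyP (yA (h' ^ h)%g _) Hhy)) ?cfunJ ?groupJ.
Qed.

Lemma double_cosetM h y k : h \in H -> k \in H ->
  ((H :* (h * y * k)) * H = (H :* y) * H)%g.
Proof.
move=> Hh Hk; rewrite !rcosetM rcoset_id // -mulgA.
by rewrite lcoset_id.
Qed.

(** This is Mackey's formula: Frobenius reciprocity writes the norm as a sum over y in G in which an
    admissible y contributes the inverse of the size of its double coset, so each admissible double
    coset adds up to 1. *)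
Lemma cfnorm_Ind_lam :
  '['Ind[G] lam] = #|[set ((H :* y) * H)%g | y in lam_adm]|%:R.
Proof.
rewrite -Frobenius_reciprocity cfdotE.
rewrite (eq_bigr (fun h => #|H|%:R^-1 * \sum_(y in G) lam h * lam (h ^ y)%g)); last first.
  move=> h Hh; rewrite cfResE // cfIndE // rmorphM /= rmorphV ?unitfE ?neq0CG //.
  rewrite rmorph_nat mulrCA -mulr_sumr; congr (_ * (_ * _)).
  rewrite rmorph_sum; apply: eq_bigr => y Gy /=.
  have [Hhy | Hhy] := boolP (h ^ y \in H)%g; last by rewrite cfun0 // conjC0.
  by rewrite -lin_charV_conj // lam_real.
rewrite -mulr_sumr exchange_big /= mulrA -invfM -natrM.
rewrite (eq_bigr _ (fun y Gy => lam_adm_sum Gy)).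
rewrite mulr_sumr (bigID (mem lam_adm)) /= [X in _ + X]big1 ?addr0; last first.
  by move=> y /andP[_ /negbTE->]; rewrite muln0 mulr0.
transitivity (\sum_(y in lam_adm) #|((H :* y) * H)%g|%:R^-1 : algC).
  apply: eq_big => [y | y /andP[Gy yA]].
    by rewrite andb_idl // inE => /andP[].
  rewrite yA muln1 -(card_double_coset y) natrM invfM -mulrA mulVf ?mulr1 //.
  exact: neq0CG.
rewrite (partition_big_imset (fun y => ((H :* y) * H)%g)) /= -sum1_card natr_sum.
apply: eq_bigr => D /imsetP[y0 y0A defD].
rewrite (eq_bigr (fun _ => #|D|%:R^-1)) => [|y /andP[_ /eqP->] //].
have memdc y : y \in D -> exists2 h, h \in H & exists2 k, k \in H & y = (h * y0 * k)%g.
  rewrite defD => /mulsgP[z k /rcosetP[h Hh ->] Hk ->].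
  by exists h => //; exists k.
rewrite (eq_bigl (fun y => y \in D)) => [|y].
  rewrite sumr_const -[LHS]mulr_natr mulVf // pnatr_eq0 -lt0n card_gt0.
  by apply/set0Pn; exists y0; rewrite defD -{1}[y0]mulg1 mem_mulg ?rcoset_refl.
apply/andP/idP => [[_ /eqP<-] | /memdc[h Hh [k Hk ->]]].
  by rewrite -{1}[y]mulg1 mem_mulg ?rcoset_refl.
have Gh := subsetP sHG h Hh; have Gk := subsetP sHG k Hk; split.
  by rewrite lam_admM.
by rewrite double_cosetM // defD.
Qed.

(** All multiplicities are 0 or 1, so the norm of the induced character counts its constituents. *)
Lemma card_lam_constt :
  #|[set i in irr_constt ('Ind[G] lam)]| =
    #|[set ((H :* y) * H)%g | y in lam_adm]|.
Proof.
apply/eqP; rewrite -(eqr_nat algC) -cfnorm_Ind_lam cfdot_sum_irr -sum1_card natr_sum.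
apply/eqP; rewrite [RHS](bigID [in irr_constt ('Ind[G] lam)]) /=.
rewrite [X in _ = _ + X]big1 ?addr0 => [|i]; last first.
  by rewrite cfdot_Ind_irr lam_proj_tr01 => /negbTE->; rewrite mul0r.
apply: eq_big => [i | i]; rewrite inE // => iI.
by rewrite cfdot_Ind_irr lam_proj_tr01 iI conjC1 mulr1.
Qed.

End GelfandCriterion.

(** Both images are in bijection with the set of pairs [(f x, f' x)]. *)
Lemma card_imset_eq (aT rT rT' : finType) (A : {set aT})
    (f : aT -> rT) (f' : aT -> rT') :
    {in A &, forall x y, (f x == f y) = (f' x == f' y)} ->
  #|[set f x | x in A]| = #|[set f' x | x in A]|.
Proof.
move=> eqff; pose h x := (f x, f' x).
have -> : [set f x | x in A] = [set z.1 | z in [set h x | x in A]].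
  by rewrite -imset_comp.
have -> : [set f' x | x in A] = [set z.2 | z in [set h x | x in A]].
  by rewrite -imset_comp.
transitivity #|[set h x | x in A]|; [|apply/esym];
  apply: card_in_imset => _ _ /imsetP[x Ax ->] /imsetP[y Ay ->] /= /eqP eqxy.
  by move: (eqxy); rewrite eqff // /h => /eqP->; rewrite (eqP eqxy).
by move: (eqxy); rewrite -eqff // /h => /eqP->; rewrite (eqP eqxy).
Qed.

Local Close Scope ring_scope.
Local Open Scope nat_scope.

(** * Pairs of involutions up to conjugacy *)

(* Acts by [f m] on each block when 0, 1, ... is cut into blocks of sizes la. *)
Fixpoint blk (f : nat -> nat -> nat) (la : seq nat) (k : nat) : nat :=
  if la is m :: la' then if k < m then f m k else m + blk f la' (k - m)
  else k.

(* A component with m points is listed as a path x_0, s x_0, t (s x_0), ...; in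
   these coordinates bs m and bt m are the action of s and t, for a path with
   fixed ends when m is odd and a cycle when m is even, and bz m is a reflection
   exchanging the two. *)
Definition bs (m i : nat) : nat :=
  if odd i then i.-1 else if i.+1 < m then i.+1 else i.

Definition bt (m i : nat) : nat :=
  if odd i then (if i.+1 < m then i.+1 else 0)
  else if i == 0 then (if odd m then 0 else m.-1) else i.-1.

Definition bz (m i : nat) : nat :=
  if odd m then m.-1 - i else if i == 0 then 0 else m - i.

Lemma bs_lt m i : i < m -> bs m i < m.
Proof. by rewrite /bs; case: ifP; [|case: ifP]; lia. Qed.

Lemma bt_lt m i : i < m -> bt m i < m.
Proof. by rewrite /bt; do 3?[case: ifP]; lia. Qed.

Lemma bz_lt m i : i < m -> bz m i < m.
Proof. by rewrite /bz; do 2?[case: ifP]; lia. Qed.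

Lemma bsK m i : i < m -> bs m (bs m i) = i.
Proof. by rewrite {2}/bs; do 2?[case: ifP]; rewrite /bs; do 2?[case: ifP]; lia. Qed.

Lemma btK m i : i < m -> bt m (bt m i) = i.
Proof. by rewrite {2}/bt; do 4?[case: ifP]; rewrite /bt; do 4?[case: ifP]; lia. Qed.

Lemma bzK m i : i < m -> bz m (bz m i) = i.
Proof. by rewrite {2}/bz; do 4?[case: ifP]; rewrite /bz; do 4?[case: ifP]; lia. Qed.

Lemma bz_bs m i : i < m -> bz m (bs m (bz m i)) = bt m i.
Proof. by rewrite /bs /bt /bz; do 8?[case: ifP]; lia. Qed.

Section BlockMaps.

Implicit Types (f g : nat -> nat -> nat) (la : seq nat).

Lemma blk_lt f la k : (forall m i, i < m -> f m i < m) ->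
  k < sumn la -> blk f la k < sumn la.
Proof.
move=> flt; elim: la k => //= m la IH k klt.
case: (ltnP k m) => km; first by apply: ltn_addr; apply: flt.
by rewrite ltn_add2l IH //; lia.
Qed.

Lemma blk_comp f g la k : (forall m i, i < m -> f m i < m) ->
  blk g la (blk f la k) = blk (fun m i => g m (f m i)) la k.
Proof.
move=> flt; elim: la k => //= m la IH k.
case: (ltnP k m) => km; first by rewrite flt.
by rewrite ltnNge leq_addr /= addKn IH.
Qed.

Lemma eq_blk f g la k : (forall m i, m \in la -> i < m -> f m i = g m i) ->
  blk f la k = blk g la k.
Proof.
elim: la k => //= m la IH k fg; case: ltnP => km; first by rewrite fg ?mem_head.
by rewrite IH // => m' i m'la; apply: fg; rewrite inE m'la orbT.
Qed.

Lemma blk_id la k : blk (fun _ i => i) la k = k.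
Proof. by elim: la k => //= m la IH k; rewrite IH; case: ltnP => // /subnKC. Qed.

Lemma nth_flatten_blk (T : eqType) (x0 : T) (s : T -> T) f (ls : seq (seq T)) k :
    (forall l i, l \in ls -> i < size l ->
       s (nth x0 l i) = nth x0 l (f (size l) i)) ->
    (forall m i, i < m -> f m i < m) ->
    k < size (flatten ls) ->
  s (nth x0 (flatten ls) k) = nth x0 (flatten ls) (blk f (shape ls) k).
Proof.
move=> sl flt; elim: ls k sl => //= l ls IH k sl klt.
rewrite nth_cat; case: ltnP => kl.
  by rewrite sl ?mem_head // nth_cat flt.
rewrite IH => [|l' i l'ls|]; last by rewrite size_cat in klt; lia.
  by rewrite nth_cat ltnNge leq_addr /= addKn.
by apply: sl; rewrite inE l'ls orbT.
Qed.

(** The first position of the block containing k, used as the label of that block. *)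
Definition bstart := blk (fun _ _ => 0).

Lemma bstart_le la k : bstart la k <= k.
Proof.
rewrite /bstart; elim: la k => //= m la IH k; case: ltnP => // km.
by have := IH (k - m); lia.
Qed.

Lemma bstart_blk f la k : (forall m i, i < m -> f m i < m) ->
  bstart la (blk f la k) = bstart la k.
Proof. exact: blk_comp. Qed.

(** Inside a block [bs] joins an even position to the next one and [bt] an odd position; hence
    blocks are connected. *)
Lemma bstart_succ la k : bstart la k.+1 = bstart la k -> k.+1 < sumn la ->
  blk bs la k = k.+1 \/ blk bt la k = k.+1.
Proof.
rewrite /bstart; elim: la k => //= m la IH k.
case: (ltnP k.+1 m) => [km _ _ | mk].
  by rewrite (ltnW km) /bs /bt; case: ifP => ok; rewrite km; [right | left].
case: ltnP => [km | mk']; first by move=> e0 _; exfalso; move: e0; rewrite /=; lia.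
rewrite subSn // => /addnI/IH{}IH lt_k.
by case: IH => [|->|->]; [lia | left | right]; lia.
Qed.

Fixpoint bsize la (k : nat) : nat :=
  if la is m :: la' then if k < m then m else bsize la' (k - m) else 0.

Lemma count_iotaD (p : pred nat) m n :
  count p (iota 0 (m + n)) =
    count p (iota 0 m) + count (fun j => p (m + j)) (iota 0 n).
Proof.
rewrite iotaD count_cat add0n; congr (_ + _).
by rewrite -[X in iota X _]addn0 iotaDl count_map.
Qed.

Lemma count_bstart la k : k < sumn la ->
  count (fun j => bstart la j == bstart la k) (iota 0 (sumn la)) = bsize la k.
Proof.
rewrite /bstart; elim: la k => //= m la IH k klt; rewrite count_iotaD.
have cnt_lo j : j \in iota 0 m -> j < m by rewrite mem_iota add0n.
have hi j : (m + j < m) = false by rewrite ltnNge leq_addr.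
under [X in _ + X]eq_count => j do rewrite hi addKn.
case: (ltnP k m) => km.
  rewrite (@eq_in_count _ _ predT) => [|j /cnt_lo ->] //.
  rewrite count_predT size_iota (@eq_in_count _ _ pred0) ?count_pred0 ?addn0 //.
  by move=> j _ /=; rewrite addn_eq0; lia.
rewrite (@eq_in_count _ _ pred0) => [|j /cnt_lo jm]; last by rewrite jm [pred0 j]/=; lia.
rewrite count_pred0 add0n -IH; last by lia.
by apply: eq_count => j; rewrite eqn_add2l.
Qed.

Lemma count_bsize la m : 0 \notin la ->
  count (fun j => bsize la j == m) (iota 0 (sumn la)) = m * count_mem m la.
Proof.
elim: la => [|m' la IH] /=; first by rewrite muln0.
rewrite inE negb_or => /andP[m'0 la0]; rewrite count_iotaD.
have hi j : (m' + j < m') = false by rewrite ltnNge leq_addr.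
under [X in _ + X]eq_count => j do rewrite hi addKn.
rewrite IH // mulnDr; congr (_ + _).
rewrite (@eq_in_count _ _ (fun _ => m' == m)) => [|j]; last first.
  by rewrite mem_iota add0n => /= ->.
case: eqP => [->|_]; last by rewrite (@eq_count _ _ pred0) ?count_pred0 ?muln0.
by rewrite (@eq_count _ _ predT) ?count_predT ?size_iota ?muln1.
Qed.

(** Within a block, [bs] fixes only the last position, and only when the size is odd. *)
Lemma count_bs_fix la : 0 \notin la ->
  count (fun j => blk bs la j == j) (iota 0 (sumn la)) = count odd la.
Proof.
elim: la => //= m la IH; rewrite inE negb_or => /andP[m0 la0].
rewrite count_iotaD.
have hi j : (m + j < m) = false by rewrite ltnNge leq_addr.
under [X in _ + X]eq_count => j do rewrite hi addKn eqn_add2l.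
rewrite IH //; congr (_ + _).
rewrite (@eq_in_count _ _ (fun j => odd m && (j == m.-1))) => [|j]; last first.
  by rewrite mem_iota add0n => /= jm; rewrite jm /bs; do 2?[case: ifP]; lia.
case: (odd m) => /=; last by rewrite (@eq_count _ _ pred0) ?count_pred0.
have -> : count (fun j => j == m.-1) (iota 0 m) = count_mem m.-1 (iota 0 m) by [].
by rewrite count_uniq_mem ?iota_uniq // mem_iota; lia.
Qed.

Lemma bt_fixP la k : k < sumn la -> blk bt la k = k -> k = bstart la k.
Proof.
rewrite /bstart; elim: la k => //= m la IH k klt.
case: (ltnP k m) => km; first by rewrite /bt; do 4?[case: ifP]; lia.
move=> e; have := IH (k - m); lia.
Qed.

(** A fixed position of [bs] is the last one of an odd block, and the reflection exchanges the two
    ends. *)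
Lemma bz_bs_fix la k : k < sumn la -> blk bs la k = k -> blk bz la k = bstart la k.
Proof.
rewrite /bstart; elim: la k => //= m la IH k klt.
case: (ltnP k m) => km; first by rewrite /bs /bz; do 4?[case: ifP]; lia.
move=> e; have := IH (k - m); lia.
Qed.


Lemma bstartS la k : bstart la k.+1 = k.+1 \/ bstart la k.+1 = bstart la k.
Proof.
rewrite /bstart; elim: la k => [|m la IH] k /=; first by left.
case: (ltnP k.+1 m) => km; first by right; rewrite (ltnW km).
case: (ltnP k m) => km'; last by rewrite subSn //; have := IH (k - m); lia.
left; have -> : k.+1 - m = 0 by lia.
have -> : blk (fun _ _ => 0) la 0 = 0 by have := bstart_le la 0; rewrite /bstart; lia.
lia.
Qed.

(** At the first position of a block of size m > 2, [bs] gives 1 whereas [bt] gives 0 or m - 1. *)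
Lemma eq_bs_bt_le2 la : 0 \notin la ->
    (forall k, k < sumn la -> blk bs la k = blk bt la k) ->
  {in la, forall m, m <= 2}.
Proof.
elim: la => //= m la IH; rewrite inE negb_or => /andP[m0 la0] st m'.
have mp : 0 < m by lia.
rewrite inE => /predU1P[->|].
  have := st 0; rewrite ltn_addr // mp /bs /bt /= => /(_ isT).
  by do 2?[case: ifP]; lia.
apply: IH => // k klt; have := st (m + k); rewrite ltn_add2l => /(_ klt).
by rewrite ltnNge leq_addr /= addKn; lia.
Qed.

Lemma count_le2 la : 0 \notin la -> {in la, forall m, m <= 2} ->
  sumn la = count_mem 1 la + 2 * count_mem 2 la /\ count odd la = count_mem 1 la.
Proof.
elim: la => //= m la IH; rewrite inE negb_or => /andP[m0 la0] le2.
have [||e1 e2] := IH; [by [] | by move=> m' m'la; apply: le2; rewrite inE m'la orbT |].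
have m2 := le2 m (mem_head _ _).
have /orP[/eqP->|/eqP->] : (m == 1) || (m == 2) by lia.
all: by split; rewrite /=; lia.
Qed.

End BlockMaps.

(** * Components of the graph of two involutions *)

Section Dihedral.

Variable T : finType.

Definition pfix (s : {perm T}) : {set T} := [set x | s x == x].

(** The list l is a whole component of the graph, in the coordinates of [bs] and [bt]. *)
Definition alt_block (s t : {perm T}) (l : seq T) : Prop :=
  [/\ uniq l, 0 < size l,
      forall x0 i, i < size l -> s (nth x0 l i) = nth x0 l (bs (size l) i)
    & forall x0 i, i < size l -> t (nth x0 l i) = nth x0 l (bt (size l) i)].

(** Admissibility for the row character, expressed through the pair of involutions alone. *)
Definition sign_match (s t : {perm T}) : Prop :=
  forall c : {perm T}, (c * s = s * c)%g -> (c * t = t * c)%g ->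
  restr_perm (pfix s) c = restr_perm (pfix t) c :> bool.

Lemma restr_perm_if (A : {set T}) (c : {perm T}) y : c \in 'N(A | 'P)%g ->
  restr_perm A c y = if y \in A then c y else y.
Proof.
move=> nA; case: ifP => [yA | /negbT yA]; first exact: restr_permE.
exact: out_perm (restr_perm_on _ _) yA.
Qed.

Lemma pfix_norm (s c : {perm T}) : (c * s = s * c)%g -> c \in 'N(pfix s | 'P)%g.
Proof.
move=> cs; apply/astabsP => y; rewrite /= apermE !inE.
by rewrite -[s (c y)]permM cs permM (inj_eq perm_inj).
Qed.

Lemma porbit_expI (p : {perm T}) x a b :
  a < #|porbit p x| -> b < #|porbit p x| -> (p ^+ a)%g x = (p ^+ b)%g x -> a = b.
Proof.
move=> am bm; rewrite !permX -!(nth_traject p am) -!(nth_traject p bm).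
have := uniq_traject_porbit p x => /uniqP/(_ a b); rewrite !inE size_traject.
by move=> inj; apply: inj.
Qed.

Lemma porbit_exp_card (p : {perm T}) x : (p ^+ #|porbit p x|)%g x = x.
Proof. by rewrite permX iter_porbit. Qed.

Section Involutions.

Variables s t : {perm T}.
Hypotheses (ss : (s * s = 1)%g) (tt : (t * t = 1)%g).
Local Notation p := (s * t)%g.

Let sK x : s (s x) = x. Proof. by rewrite -permM ss perm1. Qed.
Let tK x : t (t x) = x. Proof. by rewrite -permM tt perm1. Qed.

Let expE (r : {perm T}) a b x : a = b -> (r ^+ a)%g x = (r ^+ b)%g x.
Proof. by move=> ->. Qed.

(** The dihedral relation: s inverts [p = s * t]. *)
Lemma expXs a x : (p ^+ a)%g (s ((p ^+ a)%g x)) = s x.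
Proof.
elim: a x => [|a IH] x; first by rewrite expg0 !perm1.
by rewrite {1}(expgS p a) (expgSr p a) !permM sK tK IH.
Qed.

Lemma expXt a x : (p ^+ a)%g (t ((p ^+ a)%g x)) = t x.
Proof.
elim: a x => [|a IH] x; first by rewrite expg0 !perm1.
by rewrite {1}(expgS p a) (expgSr p a) !permM tK sK IH.
Qed.

Lemma t_p x : t (p x) = s x. Proof. by rewrite permM tK. Qed.
Lemma p_s x : p (s x) = t x. Proof. by rewrite permM sK. Qed.

Section Path.

Variable x : T.
Hypothesis tx : t x = x.
Local Notation m := #|porbit p x|.

(** As t inverts p and fixes x, it acts on the exponents as a reflection. The next lemma gives the
    other reflection, that of s. *)
Lemma path_t a : a <= m -> t ((p ^+ a)%g x) = (p ^+ (m - a))%g x.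
Proof.
move=> am; apply: (@perm_inj _ (p ^+ a)%g); rewrite expXt -permM -expgD subnK //.
by rewrite porbit_exp_card.
Qed.

Lemma path_s a : a < m -> s ((p ^+ a)%g x) = (p ^+ (m - a.+1))%g x.
Proof.
move=> am; apply: (@perm_inj _ (p ^+ a.+1)%g); rewrite -[RHS]permM -expgD subnK //.
by rewrite porbit_exp_card expgSr permM expXs p_s.
Qed.

Lemma path_block : odd m -> exists2 l, alt_block s t l & x \in l.
Proof.
(* Applying s and t alternately from x runs through the exponents 0, m - 1, 1, m - 2, ... of p; [e]
   lists them. *)
move=> odd_m; pose e i := if odd i then m - i./2.+1 else i./2.
have e_lt i : i < m -> e i < m by rewrite /e; case: ifP; lia.
exists (mkseq (fun i => (p ^+ e i)%g x) m); last first.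
  apply/mapP; exists 0; first by rewrite mem_iota; lia.
  by rewrite /e expg0 perm1.
split; rewrite ?size_mkseq; last 2 first.
- move=> x0 i im; rewrite !nth_mkseq ?bs_lt // path_s ?e_lt //.
  by apply: expE; rewrite /e /bs; do 4?[case: ifP]; lia.
- move=> x0 i im; rewrite !nth_mkseq ?bt_lt // path_t ?(ltnW (e_lt i _)) //.
  have [->|i0] := eqVneq i 0.
    by rewrite /e /bt odd_m /= subn0 porbit_exp_card expg0 perm1.
  by apply: expE; rewrite /e /bt; do 6?[case: ifP]; lia.
- rewrite map_inj_in_uniq ?iota_uniq // => i j; rewrite !mem_iota !add0n => im jm.
  move/porbit_expI => /(_ (e_lt i im) (e_lt j jm)).
  by rewrite /e; do 2?[case: ifP]; lia.
lia.
Qed.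

(* If the path from x has an even number of points, its half turn is the power
   p ^ (m / 2), which commutes with s and t on the path; it swaps the two ends,
   both fixed by t, and moves no fixed point of s. *)
Lemma path_sign_match : sign_match s t -> odd m.
Proof.
move=> st_match; apply/negPn/negP => even_m.
set O := porbit p x; pose h := m./2; pose c := restr_perm O (p ^+ h)%g.
have m0 : 0 < m by rewrite lt0n card_porbit_neq0.
have defm : (h + h = m)%N by rewrite addnn /h; lia.
have OP y : reflect (exists2 a, a < m & y = (p ^+ a)%g x) (y \in O).
  rewrite /O porbit_traject; apply: (iffP trajectP) => -[a am ->]; exists a => //.
    by rewrite permX.
  by rewrite -permX.
have cE y : c y = if y \in O then (p ^+ h)%g y else y.
  apply: restr_perm_if; apply/astabsP => z.
  by rewrite /= apermE porbit_sym porbit_perm porbit_sym.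
have Oph y : y \in O -> (p ^+ h)%g ((p ^+ h)%g y) = y.
  case/OP=> a _ ->; rewrite -2!permM -!expgD -?addnA defm addnC expgD permM.
  by rewrite porbit_exp_card.
have Op y : ((p ^+ h)%g y \in O) = (y \in O) by rewrite porbit_sym porbit_perm porbit_sym.
have Os y : (s y \in O) = (y \in O).
  suff imp z : z \in O -> s z \in O by apply/idP/idP => /imp; rewrite ?sK.
  by case/OP=> a am ->; rewrite path_s // mem_porbit.
have Ot y : (t y \in O) = (y \in O).
  suff imp z : z \in O -> t z \in O by apply/idP/idP => /imp; rewrite ?tK.
  by case/OP=> a am ->; rewrite path_t ?(ltnW am) // mem_porbit.
have cs : (c * s = s * c)%g.
  apply/permP=> y; rewrite !permM !cE Os; case: ifP => // Oy.
  by rewrite -(expXs h y) Oph // Os Op.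
have ct : (c * t = t * c)%g.
  apply/permP=> y; rewrite !permM !cE Ot; case: ifP => // Oy.
  by rewrite -(expXt h y) Oph // Ot Op.
have hm : h < m by rewrite /h; lia.
have := st_match c cs ct.
have -> : restr_perm (pfix s) c = 1%g.
  apply/permP=> y; rewrite restr_perm_if ?pfix_norm // perm1 inE cE.
  case: ifP => // sy; case: ifP => // /OP[a am def_y]; move: sy.
  rewrite def_y path_s // => /eqP/porbit_expI.
  have am' : m - a.+1 < m by lia.
  by move=> /(_ am' am); lia.
have -> : restr_perm (pfix t) c = tperm x ((p ^+ h)%g x).
  have Ox : x \in O by rewrite porbit_id.
  apply/permP=> y; rewrite restr_perm_if ?pfix_norm // inE cE.
  case: tpermP => [->|->|/eqP nx /eqP nph].
  - by rewrite tx eqxx Ox.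
  - by rewrite Op Ox path_t ?(ltnW hm) // -{1}defm addnK eqxx Oph.
  case: ifP => // ty; case: ifP => // /OP[a am def_y]; exfalso.
  have [a0|a0] := posnP a; first by rewrite def_y a0 expg0 perm1 eqxx in nx.
  move: ty; rewrite def_y path_t ?(ltnW am) // => /eqP/porbit_expI.
  have am' : m - a < m by lia.
  move=> /(_ am' am) ma; case/eqP: nph; rewrite def_y; apply: expE; lia.
rewrite odd_perm1 odd_tperm => /esym/negbFE/eqP x_h.
have := porbit_expI m0 hm; rewrite expg0 perm1 => /(_ x_h).
by rewrite /h; lia.
Qed.

End Path.

(** Without fixed points the orbit of x under p is disjoint from its image under s, and the two
    interleave in a cycle. *)
Lemma cycle_block x :
    (forall a, s ((p ^+ a)%g x) != (p ^+ a)%g x) ->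
    (forall a, t ((p ^+ a)%g x) != (p ^+ a)%g x) ->
  exists2 l, alt_block s t l & x \in l.
Proof.
move=> nfs nft; set r := #|porbit p x|.
have r0 : 0 < r by rewrite lt0n card_porbit_neq0.
(* If s mapped exponent a to exponent b, a reflection would fix the midpoint: t when a + b is odd, s
   when it is even. *)
have cross a b : s ((p ^+ a)%g x) <> (p ^+ b)%g x.
  move=> /(congr1 (p ^+ a)%g); rewrite expXs -permM -expgD => sx.
  have [odd_c | even_c] := boolP (odd (b + a)).
    pose d := (b + a).+1./2; have /eqP[] := nft d.
    apply: (@perm_inj _ (p ^+ d)%g); rewrite expXt -permM -expgD -p_s sx -permM -expgSr.
    by apply: expE; rewrite /d; lia.
  pose d := (b + a)./2; have /eqP[] := nfs d.
  apply: (@perm_inj _ (p ^+ d)%g); rewrite expXs -permM -expgD sx.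
  by apply: expE; rewrite /d; lia.
pose e i := (p ^+ i./2)%g x.
(* The cycle is x, s x, p x, s (p x), ..., with 2r points. *)
exists (mkseq (fun i => if odd i then s (e i) else e i) r.*2); last first.
  apply/mapP; exists 0; first by rewrite mem_iota; lia.
  by rewrite /e expg0 perm1.
split; rewrite ?size_mkseq; last 2 first.
- move=> x0 i im; rewrite !nth_mkseq ?bs_lt // /bs.
  have [oi | ei] := boolP (odd i).
    have -> : odd i.-1 = false by lia.
    by rewrite sK /e; apply: expE; lia.
  have -> : i.+1 < r.*2 by lia.
  by rewrite /= (negbTE ei) /= /e; congr (s _); apply: expE; lia.
- move=> x0 i im; rewrite !nth_mkseq ?bt_lt // /bt.
  have [oi | ei] := boolP (odd i).
    have -> : t (s (e i)) = (p ^+ i./2.+1)%g x by rewrite expgSr !permM.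
    case: (ltnP i.+1 r.*2) => im1.
      have -> : odd i.+1 = false by rewrite /= oi.
      by apply: expE; lia.
    have -> : i./2.+1 = r by lia.
    by rewrite porbit_exp_card /e expg0 perm1.
  have [i0|i0] := eqVneq i 0.
    rewrite i0 odd_double.
    have -> : odd r.*2.-1 by lia.
    rewrite /e expg0 perm1 -{1}(porbit_exp_card p x) -/r -{1}(prednK r0).
    rewrite expgSr permM t_p; congr (s _); apply: expE; lia.
  have -> : odd i.-1 by lia.
  have -> : e i = p (e i.-1).
    by rewrite /e -permM -expgSr; apply: expE; lia.
  by rewrite t_p.
- rewrite map_inj_in_uniq ?iota_uniq // => i j; rewrite !mem_iota !add0n => im jm.
  have [oi|ei] := boolP (odd i); have [oj|ej] := boolP (odd j).
  + move/perm_inj/porbit_expI; rewrite -/r; lia.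
  + by move/cross.
  + by move/esym/cross.
  + move/porbit_expI; rewrite -/r; lia.
lia.
Qed.

End Involutions.

(** The component of a fixed point of s or t is its orbit under [s * t], so all path components have
    odd size. *)
Definition path_odd (s t : {perm T}) : Prop :=
  forall x, (s x == x) || (t x == x) -> odd #|porbit (s * t)%g x|.

Lemma porbit_mulC_invol (s t : {perm T}) x : (s * s = 1)%g -> (t * t = 1)%g ->
  porbit (t * s)%g x = porbit (s * t)%g x.
Proof.
move=> ss tt; rewrite -[RHS]porbitV invMg; congr (porbit (_ * _)%g _).
  by apply: (mulgI t); rewrite mulgV.
by apply: (mulgI s); rewrite mulgV.
Qed.

Lemma sign_match_path_odd (s t : {perm T}) : (s * s = 1)%g -> (t * t = 1)%g ->
  sign_match s t -> path_odd s t.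
Proof.
move=> ss tt st x /orP[] /eqP fx; last exact: path_sign_match.
rewrite -porbit_mulC_invol //; apply: path_sign_match => // c ct cs.
by apply/esym/st.
Qed.

Lemma alt_block_stable (s t : {perm T}) l x : alt_block s t l -> x \in l ->
  s x \in l /\ t x \in l.
Proof.
move=> [_ _ sl tl] xl; rewrite -(nth_index x xl) sl ?tl ?index_mem //.
by split; apply: mem_nth; rewrite ?bs_lt ?bt_lt ?index_mem.
Qed.

(** Neighbours in the list are exchanged by s or by t, so membership in a stable set propagates
    along the block. *)
Lemma alt_block_sub (s t : {perm T}) (R : {set T}) l x : alt_block s t l ->
    {in R, forall x, s x \in R} -> {in R, forall x, t x \in R} ->
  x \in l -> x \in R -> {subset l <= R}.
Proof.
move=> lblk sR tR xl Rx; have [_ _ sl tl] := lblk.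
have [ss tt] : (forall y, y \in l -> s (s y) = y) /\ (forall y, y \in l -> t (t y) = y).
  split=> y yl; rewrite -(nth_index y yl).
    by rewrite !sl ?bs_lt ?bsK ?index_mem.
  by rewrite !tl ?bt_lt ?btK ?index_mem.
have step j : j.+1 < size l -> (nth x l j.+1 \in R) = (nth x l j \in R).
  move=> jl; have jl' := ltnW jl.
  have [jt|js] := boolP (odd j).
    have e1 : t (nth x l j) = nth x l j.+1 by rewrite tl // /bt jt jl.
    rewrite -e1; apply/idP/idP => [/tR | /tR //].
    by rewrite tt // mem_nth.
  have e1 : s (nth x l j) = nth x l j.+1 by rewrite sl // /bs (negbTE js) jl.
  rewrite -e1; apply/idP/idP => [/sR | /sR //].
  by rewrite ss // mem_nth.
have nth0 j : j < size l -> (nth x l j \in R) = (nth x l 0 \in R).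
  by elim: j => // j IH jl; rewrite step // IH // ltnW.
move=> y yl; rewrite -(nth_index x yl) nth0 ?index_mem //.
by rewrite -(nth0 (index x l)) ?index_mem // nth_index.
Qed.

(** Induction on the size of R, removing one component at a time: a path from a fixed point of t if
    there is one, otherwise a cycle. *)
Lemma block_decomp (s t : {perm T}) (R : {set T}) :
    (s * s = 1)%g -> (t * t = 1)%g -> path_odd s t ->
    {in R, forall x, s x \in R} -> {in R, forall x, t x \in R} ->
  exists ls : seq (seq T), [/\ forall l, l \in ls -> alt_block s t l,
    uniq (flatten ls) & flatten ls =i R].
Proof.
move=> ss tt st_odd; have [N] := ubnP #|R|; elim: N R => // N IH R ltR sR tR.
have sK x : s (s x) = x by rewrite -permM ss perm1.
have tK x : t (t x) = x by rewrite -permM tt perm1.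
have [->|[x0 Rx0]] := set_0Vmem R.
  by exists [::]; split=> // x; rewrite inE.
suff [l lblk [x xl Rx]] : exists2 l, alt_block s t l & exists2 x, x \in l & x \in R.
  have lR : {subset l <= R} by apply: alt_block_sub lblk _ _ xl Rx.
  have [||| ls [lsblk Uls lsR]] := IH (R :\: [set y in l]).
  - have: R :\: [set y in l] \proper R.
      apply/properP; split; first exact: subsetDl.
      by exists x; rewrite // !inE xl.
    by move/proper_card; lia.
  - move=> y; rewrite !inE => /andP[yl Ry]; rewrite sR // andbT.
    by apply: contra yl => /(alt_block_stable lblk)[]; rewrite sK.
  - move=> y; rewrite !inE => /andP[yl Ry]; rewrite tR // andbT.
    by apply: contra yl => /(alt_block_stable lblk)[]; rewrite tK.
  exists (l :: ls); split.
  - by move=> l'; rewrite inE => /predU1P[-> | /lsblk].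
  - rewrite /= cat_uniq Uls andbT; case: (lblk) => -> _ _ _ /=.
    by apply/hasPn=> y; rewrite lsR !inE => /andP[].
  move=> y; rewrite /= mem_cat lsR !inE.
  by have [/lR -> | //] := boolP (y \in l).
have pR a x : x \in R -> ((s * t) ^+ a)%g x \in R.
  elim: a => [|a IHa] Rx; first by rewrite expg0 perm1.
  by rewrite expgSr !permM tR // sR // IHa.
have [x /andP[Rx /eqP tx] | no_t] := pickP (fun x => (x \in R) && (t x == x)).
  have [|l lblk xl] := path_block ss tt tx; first by rewrite st_odd ?tx ?eqxx ?orbT.
  by exists l => //; exists x.
(* With no fixed point of t in R there is none of s either: the middle of the odd path starting at y
   would be fixed by t. *)
have [y /andP[Ry /eqP sy] | no_s] := pickP (fun x => (x \in R) && (s x == x)).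
  have := st_odd y; rewrite sy eqxx -porbit_mulC_invol // => /(_ isT) odd_m.
  set m := #|_| in odd_m; have am : m./2 < m by lia.
  have := path_s tt ss sy am.
  have -> : m - (m./2).+1 = m./2 by lia.
  move=> ty; have := no_t (((t * s) ^+ m./2)%g y); rewrite ty eqxx andbT.
  suff -> : ((t * s) ^+ m./2)%g y \in R by [].
  elim: (m./2) => [|a IHa]; first by rewrite expg0 perm1.
  by rewrite expgSr !permM sR // tR.
have [a||l lblk xl] := @cycle_block _ _ ss tt x0.
- by have := no_s (((s * t) ^+ a)%g x0); rewrite pR // => /negbT.
- by move=> a; have := no_t (((s * t) ^+ a)%g x0); rewrite pR // => /negbT.
by exists l => //; exists x0.
Qed.

End Dihedral.

(** * Standard pairs of involutions indexed by partitions *)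

Section StandardPairs.

Variable n : nat.
Implicit Type la : intpart n.

Lemma sumn_parts la : sumn la = n.
Proof. by have /and3P[_ _ /eqP] := partsP la. Qed.

Lemma parts_gt0 la : 0 \notin parts la.
Proof. by have /and3P[] := partsP la. Qed.

Definition std_fun (f : nat -> nat -> nat) la (i : 'I_n) : 'I_n :=
  insubd i (blk f la i).

Section StdFun.

Variable f : nat -> nat -> nat.
Hypothesis f_lt : forall m i, i < m -> f m i < m.
Hypothesis fK : forall m i, i < m -> f m (f m i) = i.

Lemma val_std_fun la i : std_fun f la i = blk f la i :> nat.
Proof. by rewrite val_insubd -[X in _ < X](sumn_parts la) blk_lt ?sumn_parts. Qed.

Lemma std_funK la : involutive (std_fun f la).
Proof.
move=> i; apply: val_inj; rewrite /= !val_std_fun blk_comp //.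
by rewrite (@eq_blk _ (fun _ i => i)) ?blk_id // => m j _ /fK.
Qed.

Definition std_perm la : 'S_n := perm (inv_inj (std_funK la)).

Lemma std_permE la i : std_perm la i = blk f la i :> nat.
Proof. by rewrite permE val_std_fun. Qed.

Lemma std_permK la : (std_perm la * std_perm la = 1)%g.
Proof. by apply/permP=> i; rewrite permM !permE std_funK. Qed.

End StdFun.

Definition bS := std_perm bs_lt bsK.
Definition bT := std_perm bt_lt btK.
Definition bZ := std_perm bz_lt bzK.

Lemma bSJ la : ((bS la) ^ (bZ la) = bT la)%g.
Proof.
have ZV : ((bZ la)^-1 = bZ la)%g by apply: (mulgI (bZ la)); rewrite mulgV std_permK.
apply/permP=> i; apply: val_inj.
rewrite /= conjgE ZV !permM !std_permE (blk_comp _ _ _ bz_lt).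
rewrite blk_comp => [|m j /bz_lt/bs_lt //].
by apply: eq_blk => m j _ /bz_bs.
Qed.

(** The component sizes, sorted in decreasing order, form the partition; the conjugating g sends a
    position to the point listed there in the concatenated components. *)
Lemma std_form (s t : 'S_n) : (s * s = 1)%g -> (t * t = 1)%g -> path_odd s t ->
  exists la (g : 'S_n), s = (bS la ^ g)%g /\ t = (bT la ^ g)%g.
Proof.
move=> ss tt st_odd.
have [||ls [lsb Uls ls_all]] := block_decomp (R := [set: 'I_n]) ss tt st_odd.
- by move=> x; rewrite inE.
- by move=> x; rewrite inE.
pose leS := relpre (@size 'I_n) geq.
pose ls' := sort leS ls; pose e := flatten ls'.
have pls : perm_eq ls' ls by rewrite perm_sort.
have pe : perm_eq e (flatten ls) by apply: perm_flatten.
have Ue : uniq e by rewrite (perm_uniq pe).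
have ls'b l : l \in ls' -> alt_block s t l by rewrite (perm_mem pls); apply: lsb.
have size_e : size e = n.
  rewrite -[RHS]card_ord -cardsT -(card_uniqP Ue); apply: eq_card => x.
  by rewrite (perm_mem pe) ls_all.
have laP : is_intpart n (shape ls').
  apply/and3P; split; last by rewrite -size_flatten -/e size_e.
    rewrite sorted_map; apply: sort_sorted => l l'; exact: leq_total.
  by apply/mapP=> -[l /ls'b[_ l0 _ _] l00]; rewrite -l00 in l0.
pose la := IntPart laP.
pose gf (i : 'I_n) := nth i e i.
have gf_inj : injective gf.
  move=> i j; rewrite /gf (set_nth_default i) ?size_e // => /eqP.
  by rewrite nth_uniq ?size_e // => /eqP/val_inj.
pose g := perm gf_inj; exists la, g.
have conjP (r : 'S_n) f (f_lt : forall m i, i < m -> f m i < m)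
    (fK : forall m i, i < m -> f m (f m i) = i) :
    (forall l x0 i, l \in ls' -> i < size l ->
       r (nth x0 l i) = nth x0 l (f (size l) i)) ->
    (r = std_perm f_lt fK la ^ g)%g.
  move=> rP; apply/permP=> y; rewrite -[y](permKV g); set i := (g^-1)%g y.
  rewrite permJ !permE /gf (nth_flatten_blk (f := f)) ?size_e //.
  - rewrite [RHS](set_nth_default i) ?size_e //; congr nth; exact/esym/val_std_fun.
  by move=> l j /rP; apply.
by split; apply: conjP => l x0 i /ls'b[_ _ sl tl]; [apply: sl | apply: tl].
Qed.


Lemma card_ord_count (P : pred nat) : #|[set j : 'I_n | P j]| = count P (iota 0 n).
Proof.
rewrite cardsE cardE size_filter -enumT -val_enum_ord count_map.
by apply: eq_count.
Qed.

Lemma intpart_eqP la la' :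
  (forall m, 0 < m -> count_mem m la = count_mem m la') -> la = la'.
Proof.
move=> eq_count; apply: val_inj; apply: (@sorted_eq _ geq).
- by move=> a b c ab bc; apply: leq_trans bc ab.
- by move=> a b; rewrite andbC -eqn_leq => /eqP.
- by have /and3P[] := partsP la.
- by have /and3P[] := partsP la'.
apply/allP => m _ /=; case: (posnP m) => [->|/eq_count->//].
by rewrite !(count_memPn _) ?parts_gt0.
Qed.

Definition st_rel (s t : 'S_n) : rel 'I_n := fun x y => (y == s x) || (y == t x).

Lemma connect_mono (e e' : rel 'I_n) (f : 'I_n -> 'I_n) :
    (forall x y, e x y -> e' (f x) (f y)) ->
  forall x y, connect e x y -> connect e' (f x) (f y).
Proof.
move=> ee' x y /connectP[p]; elim: p x => [|z p IH] x /=.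
  by move=> _ ->; apply: connect0.
by case/andP=> /ee' xz pz yl; apply: connect_trans (connect1 xz) (IH _ pz yl).
Qed.

Lemma connect_invariant (e : rel 'I_n) (f : 'I_n -> nat) :
    (forall x y, e x y -> f x = f y) ->
  forall x y, connect e x y -> f x = f y.
Proof.
move=> fe x y /connectP[p]; elim: p x => [|z p IH] x /= => [_ -> //|].
by case/andP=> /fe-> pz /IH->.
Qed.

(** Both involutions preserve [bstart]; conversely each block start is linked to the positions of
    its block one step at a time. *)
Lemma std_connect la i j :
  connect (st_rel (bS la) (bT la)) i j = (bstart la i == bstart la j).
Proof.
set e := st_rel _ _.
have e_sym : connect_sym e.
  have sK x : bS la (bS la x) = x by rewrite -permM std_permK perm1.
  have tK x : bT la (bT la x) = x by rewrite -permM std_permK perm1.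
  apply: sym_connect_sym => x y; rewrite /e /st_rel.
  by congr (_ || _); apply/eqP/eqP=> ->; rewrite ?sK ?tK.
apply/idP/eqP => [|ij].
  apply: (connect_invariant (f := fun x : 'I_n => bstart la x)) => x y.
  by case/orP=> /eqP->; rewrite std_permE bstart_blk //; [apply: bs_lt | apply: bt_lt].
have to_start k (kn : k < n) (x : 'I_n) : x = bstart la k :> nat ->
    connect e x (Ordinal kn).
  elim: k kn => [|k IH] kn xk.
    have -> : x = Ordinal kn; last exact: connect0.
    by apply: val_inj; rewrite /= xk; have := bstart_le la 0; lia.
  have [st | st] := bstartS la k.
    have -> : x = Ordinal kn; last exact: connect0.
    by apply: val_inj; rewrite /= xk.
  apply: connect_trans (IH (ltnW kn) _) _; first by rewrite -st.
  apply: connect1; rewrite /e /st_rel; apply/orP.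
  have [|eq1|eq1] := bstart_succ st; first by rewrite sumn_parts.
    by left; rewrite -val_eqE /= std_permE eq1.
  by right; rewrite -val_eqE /= std_permE eq1.
have st_lt : bstart la i < n by apply: leq_ltn_trans (bstart_le _ _) (ltn_ord i).
have start_ord (k x : 'I_n) : x = bstart la k :> nat -> connect e x k.
  by case: k => k kn; apply: to_start.
apply: (connect_trans (y := Ordinal st_lt)); last exact: start_ord.
by rewrite e_sym; apply: start_ord.
Qed.

Lemma connect_conj (s t g : 'S_n) x y :
  connect (st_rel (s ^ g)%g (t ^ g)%g) (g x) (g y) = connect (st_rel s t) x y.
Proof.
have eJ u v : st_rel (s ^ g)%g (t ^ g)%g (g u) (g v) = st_rel s t u v.
  by rewrite /st_rel !permJ !(inj_eq perm_inj).
apply/idP/idP; last by apply: connect_mono => u v; rewrite eJ.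
move/(@connect_mono _ (st_rel s t) (g^-1)%g); rewrite !permK; apply=> u v.
by rewrite -{1}[u](permKV g) -{1}[v](permKV g) eJ.
Qed.

(** The multiplicities of the parts are read off the graph of the pair, which makes the partition an
    invariant of simultaneous conjugacy. *)
Lemma card_components la (g : 'S_n) m :
  #|[set x | #|[set y | connect (st_rel (bS la ^ g) (bT la ^ g))%g x y]| == m]|
    = m * count_mem m la.
Proof.
rewrite -count_bsize ?parts_gt0 // sumn_parts -card_ord_count.
rewrite -(card_imset [set j : 'I_n | bsize la j == m] (@perm_inj _ g)).
apply: eq_card => x; rewrite -[x](permKV g) mem_imset ?inE; last exact: perm_inj.
set i := (g^-1)%g x; congr (_ == m).
rewrite -(count_bstart (la := la)) ?sumn_parts // -card_ord_count.
rewrite -(card_imset [set j : 'I_n | bstart la j == bstart la i] (@perm_inj _ g)).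
apply: eq_card => y; rewrite -[y](permKV g) mem_imset ?inE; last exact: perm_inj.
by rewrite connect_conj std_connect eq_sym.
Qed.

Lemma std_form_uniq la la' (g g' : 'S_n) :
    (bS la ^ g = bS la' ^ g')%g -> (bT la ^ g = bT la' ^ g')%g -> la = la'.
Proof.
move=> eS eT; apply: intpart_eqP => m m0; apply/eqP; rewrite -(eqn_pmul2l m0).
by rewrite -(card_components la g) -(card_components la' g') eS eT.
Qed.

Lemma pfixJ (s g : 'S_n) : pfix (s ^ g)%g = g @: pfix s.
Proof.
apply/setP=> x; rewrite -[x](permKV g) mem_imset; last exact: perm_inj.
by rewrite !inE permJ (inj_eq perm_inj).
Qed.

Lemma card_pfix_bS la : #|pfix (bS la)| = odd_parts la.
Proof.
rewrite /odd_parts -count_bs_fix ?parts_gt0 // sumn_parts -card_ord_count.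
by apply: eq_card => i; rewrite !inE -val_eqE /= std_permE.
Qed.

Lemma porbit_fix (p : 'S_n) x : p x = x -> #|porbit p x| = 1.
Proof.
move=> px; have := card_porbit_neq0 p x.
case: #|_| (@porbit_expI _ p x 0 1) => [|[|r]] // inj _.
by have := inj isT isT; rewrite expg0 expg1 perm1 px => /(_ erefl).
Qed.

(* The standard form of the pair (s, s) has blocks of size 1 and 2 only. *)
Lemma involution_conj (s s' : 'S_n) : (s * s = 1)%g -> (s' * s' = 1)%g ->
  #|pfix s| = #|pfix s'| -> exists g, s' = (s ^ g)%g.
Proof.
move=> ss ss' eq_fix.
have form (r : 'S_n) : (r * r = 1)%g -> exists la g, [/\ r = (bS la ^ g)%g,
    sumn la = count_mem 1 la + 2 * count_mem 2 la, odd_parts la = count_mem 1 la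
    & {in parts la, forall m, m <= 2}].
  move=> rr; have [|la [g [rS rT]]] := std_form rr rr.
    by move=> x; rewrite orbb => /eqP rx; rewrite porbit_fix ?permM ?rx.
  have le2 : {in parts la, forall m, m <= 2}.
    apply: eq_bs_bt_le2; first exact: parts_gt0.
    move=> k; rewrite sumn_parts => kn; have ST : bS la = bT la.
      by apply: (@conjg_inj _ g); rewrite -rS.
    by have := congr1 (fun p : 'S_n => val (p (Ordinal kn))) ST; rewrite /= !std_permE.
  have [e1 e2] := count_le2 (parts_gt0 la) le2.
  by exists la, g.
have [la [g [sE sum1 odd1 le1]]] := form s ss.
have [la' [g' [sE' sum2 odd2 le2]]] := form s' ss'.
have oddE : odd_parts la = odd_parts la'.
  rewrite -!card_pfix_bS; move: eq_fix; rewrite sE sE' !pfixJ.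
  by rewrite !card_imset //; apply: perm_inj.
suff -> : s' = (s ^ (g^-1 * g'))%g by exists (g^-1 * g')%g.
suff eq_la : la = la' by rewrite sE sE' conjgM conjgK eq_la.
apply: intpart_eqP => m m0.
have := sumn_parts la; rewrite sum1 => n1; have := sumn_parts la'; rewrite sum2 => n2.
have [m2 | m2] := leqP m 2; last first.
  have -> : count_mem m la = 0 by apply/count_memPn/negP=> /le1; lia.
  by apply/esym/count_memPn/negP=> /le2; lia.
have /orP[/eqP->|/eqP->] : (m == 1) || (m == 2) by lia.
  by rewrite -odd1 oddE odd2.
lia.
Qed.

Lemma restr_permJ (A : {set 'I_n}) (c g : 'S_n) : c \in 'N(A | 'P)%g ->
  restr_perm (g @: A) (c ^ g)%g = (restr_perm A c ^ g)%g.
Proof.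
move=> nA; have nAg : (c ^ g)%g \in 'N(g @: A | 'P)%g.
  apply/astabsP=> x; rewrite /= apermE -[x](permKV g) permJ.
  rewrite !mem_imset; try exact: perm_inj.
  by have /astabsP/(_ ((g^-1)%g x)) := nA; rewrite /= apermE.
apply/permP=> x; rewrite -[x](permKV g) permJ !restr_perm_if // permJ.
by rewrite mem_imset; [case: ifP | apply: perm_inj].
Qed.

Lemma sign_matchJ (s t g : 'S_n) : sign_match s t -> sign_match (s ^ g)%g (t ^ g)%g.
Proof.
move=> st c cs ct; rewrite !pfixJ -[c](conjgKV g); set c' := (c ^ g^-1)%g.
have commJ (r : 'S_n) : (c * r ^ g = r ^ g * c)%g -> (c' * r = r * c')%g.
  by move=> cr; apply: (@conjg_inj _ g); rewrite [LHS]conjMg [RHS]conjMg /c' conjgKV.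
have [/commJ c's /commJ c't] := (cs, ct).
by rewrite !restr_permJ ?pfix_norm // !odd_permJ st.
Qed.

(* A fixed point of T is the first point of its component, so the conjugation by
   Z carries the action of c on the fixed points of S to that on those of T. *)
Lemma std_sign_match la : sign_match (bS la) (bT la).
Proof.
move=> c cS cT; set Z := bZ la.
have ZK x : Z (Z x) = x by rewrite -permM std_permK perm1.
have fixZ x : (Z x \in pfix (bT la)) = (x \in pfix (bS la)).
  by rewrite -bSJ pfixJ mem_imset //; apply: perm_inj.
have c_fix (r : 'S_n) x : (c * r = r * c)%g -> (c x \in pfix r) = (x \in pfix r).
  by move=> /pfix_norm/astabsP/(_ x); rewrite /= apermE.
have cZ x : x \in pfix (bS la) -> c (Z x) = Z (c x).
  move=> Sx; have Scx : c x \in pfix (bS la) by rewrite c_fix.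
  have Tcx : c (Z x) \in pfix (bT la) by rewrite c_fix // fixZ.
  have startE y : y \in pfix (bS la) -> Z y = bstart la y :> nat.
    rewrite inE -val_eqE /= std_permE => /eqP Sy.
    by rewrite std_permE bz_bs_fix ?sumn_parts.
  apply: val_inj; rewrite /= startE //.
  have Tst : c (Z x) = bstart la (c (Z x)) :> nat.
    apply: bt_fixP; first by rewrite sumn_parts.
    by move: Tcx; rewrite inE -val_eqE /= std_permE => /eqP.
  rewrite Tst; apply/eqP; rewrite -std_connect.
  apply: (connect_mono (e := st_rel (bS la) (bT la))) => [u v|].
    by case/orP=> /eqP->; rewrite /st_rel -!permM ?cS ?cT eqxx ?orbT.
  by rewrite std_connect std_permE bstart_blk //; apply: bz_lt.
suff -> : restr_perm (pfix (bT la)) c = (restr_perm (pfix (bS la)) c ^ Z)%g.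
  by rewrite odd_permJ.
apply/permP=> y; rewrite -[y]ZK permJ !restr_perm_if ?pfix_norm // fixZ.
by case: ifP => // /cZ.
Qed.

End StandardPairs.

(** * The models of the symmetric group *)

Section InvolutionGelfand.

Variables (n : nat) (t0 : 'S_n) (G H : {group 'S_n}) (lam : 'CF(H)).
Hypotheses (t0t0 : (t0 * t0 = 1)%g) (sHG : H \subset G).
Hypotheses (memH : forall h, (h \in H) = ((h * t0 == t0 * h)%g)).
Hypotheses (Llam : lam \is a linear_char).
Hypotheses (lam2 : {in H, forall h, lam h ^+ 2 = 1}%R).
Hypothesis adm_odd : {in lam_adm G lam, forall g, path_odd t0 (t0 ^ g)%g}.

Lemma conjg_eqH (a b : 'S_n) : (t0 ^ a = t0 ^ b)%g -> (a * b^-1)%g \in H.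
Proof.
move=> ab; rewrite memH; apply/eqP.
have: (t0 ^ (a * b^-1) = t0)%g by rewrite conjgM ab conjgK.
by rewrite conjgE => /(canRL (mulKVg _)).
Qed.

Lemma conjg_idH h : h \in H -> (t0 ^ h = t0)%g.
Proof. by rewrite memH conjgE => /eqP<-; rewrite mulKg. Qed.

Lemma involM g : (t0 ^ g * t0 ^ g = 1)%g.
Proof. by rewrite -conjMg t0t0 conj1g. Qed.

Lemma adm_form g : g \in lam_adm G lam ->
  exists la a, t0 = (bS la ^ a)%g /\ (t0 ^ g)%g = (bT la ^ a)%g.
Proof. by move/adm_odd; apply: std_form => //; apply: involM. Qed.

(** The conjugated reflection z exchanges t0 and [t0 ^ g], so z and g differ by an element of H, the
    centralizer of t0. The element of g H produced is g z g^-1. *)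
Lemma adm_involution : {in lam_adm G lam, forall g,
  exists2 h, h \in H & ((g * h) * (g * h) = 1)%g}.
Proof.
move=> g /adm_form[la [a [eS eT]]]; pose z := (bZ la ^ a)%g.
have zz : (z * z = 1)%g by rewrite -conjMg std_permK conj1g.
have t0z : (t0 ^ z = t0 ^ g)%g by rewrite eT eS -conjJg bSJ.
exists (z * g^-1)%g; first exact: conjg_eqH.
have -> : (g * (z * g^-1) = z ^ g^-1)%g by rewrite conjgE invgK.
by rewrite -conjMg zz conj1g.
Qed.

(** The partition of component sizes of the pair t0, [t0 ^ g]; every admissible g has one. *)
Definition pair_type (g : 'S_n) : option (intpart n) :=
  [pick la : intpart n | [exists a : 'S_n,
     (t0 == (bS la ^ a)%g) && ((t0 ^ g)%g == (bT la ^ a)%g)]].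

Lemma pair_typeE g la a :
  t0 = (bS la ^ a)%g -> (t0 ^ g)%g = (bT la ^ a)%g -> pair_type g = Some la.
Proof.
move=> eS eT; rewrite /pair_type; case: pickP => [la' /existsP[b /andP[/eqP eS' /eqP eT']]|].
  by congr Some; apply: (@std_form_uniq _ _ _ b a); rewrite -?eS' -?eT'.
by move/(_ la)/existsP; case; exists a; rewrite -eS -eT !eqxx.
Qed.

(** As H is the centralizer of t0, double cosets of H correspond to pairs t0, [t0 ^ g] up to
    simultaneous conjugacy, and [std_form_uniq] shows that these are separated by their
    partitions. *)
Lemma pair_type_dcoset : {in lam_adm G lam &, forall g g',
  (((H :* g) * H)%g == ((H :* g') * H)%g) = (pair_type g == pair_type g')}.
Proof.
move=> g g' /adm_form[la [a [eS eT]]] /adm_form[la' [a' [eS' eT']]].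
rewrite (pair_typeE eS eT) (pair_typeE eS' eT').
apply/eqP/eqP => [HgH | [laE]].
  have : g' \in ((H :* g) * H)%g.
    by rewrite HgH -{1}[g']mulg1 mem_mulg ?rcoset_refl.
  case/mulsgP=> y k /rcosetP[h Hh ->] Hk def_g'.
  have eT2 : (t0 ^ g' = bT la ^ (a * k))%g.
    by rewrite def_g' !conjgM conjg_idH // eT.
  have eS2 : (t0 = bS la ^ (a * k))%g by rewrite conjgM -eS conjg_idH.
  by congr Some; apply: (@std_form_uniq _ _ _ (a * k)%g a'); rewrite -?eS2 -?eS' -?eT2 -?eT'.
subst la'; pose b := (a^-1 * a')%g.
have Hb : b \in H.
  have := @conjg_eqH b 1%g; rewrite invg1 mulg1; apply.
  by rewrite conjg1 /b {1}eS conjgM conjgK -eS'.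
have Hc : (g' * (g * b)^-1)%g \in H.
  apply: conjg_eqH; rewrite eT' conjgM eT /b.
  by rewrite conjgM conjgK.
rewrite -[g'](mulgKV (g * b)%g) mulgA.
by rewrite (double_cosetM g Hc Hb).
Qed.

(** The two conditions on P say that it is the set of partitions of admissible pairs; [pair_type]
    then matches P with the admissible double cosets. *)
Lemma involution_gelfand (C : numClosedFieldType) (iota : {rmorphism algC -> C})
    (P : {set intpart n}) :
    (forall g la a, g \in lam_adm G lam ->
       t0 = (bS la ^ a)%g -> (t0 ^ g)%g = (bT la ^ a)%g -> la \in P) ->
    (forall la, la \in P -> exists2 g, g \in lam_adm G lam &
       exists a, t0 = (bS la ^ a)%g /\ (t0 ^ g)%g = (bT la ^ a)%g) ->
  linear_gelfand_triple G lam /\ twisted_dcalg_iso G iota lam #|P|.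
Proof.
move=> admP Padm; split; first exact: gelfand_triple_crit adm_involution.
suff -> : #|P| = #|[set i in irr_constt ('Ind[G] lam)%R]|.
  exact: (dcalg_iso sHG Llam lam2 adm_involution iota).
rewrite (card_lam_constt sHG Llam lam2 adm_involution).
rewrite (card_imset_eq pair_type_dcoset) -(card_imset P (@Some_inj _)).
congr #|pred_of_set _|; apply/setP=> x; apply/imsetP/imsetP.
  case=> la /Padm[g gA [a [eS eT]]] ->; exists g => //.
  by rewrite (pair_typeE eS eT).
case=> g gA ->; have [la [a [eS eT]]] := adm_form gA.
by exists la; [apply: admP eS eT | rewrite (pair_typeE eS eT)].
Qed.

End InvolutionGelfand.

(** * The involution of the pairing and its centralizer *)

Section BaseInvolution.

Variables k q : nat.
Local Notation n := (2 * k + q).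

(** The product of the k transpositions of paired points; on the first 2k points [bs] exchanges each
    even position with its successor. *)
Definition base_fun (i : 'I_n) : 'I_n := insubd i (if i < 2 * k then bs (2 * k) i else i).

Lemma val_base_fun i : base_fun i = (if i < 2 * k then bs (2 * k) i else i) :> nat.
Proof.
rewrite val_insubd; case: ifP => // /negP[]; have := ltn_ord i.
by case: (ltnP i (2 * k)) => // /bs_lt; lia.
Qed.

Lemma base_funK : involutive base_fun.
Proof.
move=> i; apply: val_inj; rewrite /= !val_base_fun.
by case: (ltnP i (2 * k)) => ik; [rewrite bs_lt // bsK | rewrite ltnNge ik].
Qed.

Definition base_inv : 'S_n := perm (inv_inj base_funK).

Lemma base_inv_sq : (base_inv * base_inv = 1)%g.
Proof. by apply/permP=> i; rewrite permM !permE base_funK. Qed.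

Lemma base_invK i : base_inv (base_inv i) = i.
Proof. by rewrite !permE base_funK. Qed.

Lemma base_inv_val (i : 'I_n) : i < 2 * k ->
  base_inv i = (if odd i then i.-1 else i.+1) :> nat.
Proof.
by move=> ik; rewrite permE val_base_fun ik /bs; do 2?[case: ifP]; lia.
Qed.

Lemma base_inv_last (i : 'I_n) : 2 * k <= i -> base_inv i = i.
Proof. by move=> ki; apply: val_inj; rewrite permE /= val_base_fun ltnNge ki. Qed.

Lemma pfix_base : pfix base_inv = last_pts k q.
Proof.
apply/setP=> i; rewrite !inE; case: (ltnP i (2 * k)) => [ik | /base_inv_last->].
  by apply/eqP=> /(congr1 val)/=; rewrite base_inv_val //; case: ifP; lia.
by rewrite eqxx.
Qed.

Lemma card_last_pts : #|last_pts k q| = q.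
Proof.
rewrite (card_ord_count _ (fun i => 2 * k <= i)) count_iotaD.
rewrite (@eq_in_count _ _ pred0) ?count_pred0 => [|i]; last first.
  by rewrite mem_iota => /andP[_ ik]; apply/negbTE; rewrite -ltnNge.
rewrite (@eq_count _ _ predT) ?count_predT ?size_iota // => i.
by rewrite leq_addr.
Qed.

Lemma first_last : first_pts k q = ~: last_pts k q.
Proof. by apply/setP=> i; rewrite !inE ltnNge. Qed.

Lemma base_inv_first i : (base_inv i \in first_pts k q) = (i \in first_pts k q).
Proof. by rewrite first_last !in_setC -pfix_base !inE base_invK eq_sym. Qed.

Lemma pairingP (B : {set 'I_n}) :
  reflect (exists2 x, x \in first_pts k q & B = [set x; base_inv x]) (B \in pairing k q).
Proof.
have pairE (x : 'I_n) : x < 2 * k -> [set i : 'I_n | i./2 == x./2] = [set x; base_inv x].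
  move=> xk; apply/setP=> i; rewrite !inE -!val_eqE /= base_inv_val //.
  by case: ifP; lia.
apply: (iffP imsetP) => [[j _ ->]|[x]].
  have jn : (j : nat).*2 < n by have := ltn_ord j; lia.
  have jk : Ordinal jn < 2 * k by have := ltn_ord j; rewrite /=; lia.
  exists (Ordinal jn); first by rewrite inE.
  by rewrite -pairE //=; apply/setP=> i; rewrite !inE doubleK.
rewrite inE => xk ->; have jk : x./2 < k by lia.
by exists (Ordinal jk) => //; rewrite -pairE.
Qed.

Lemma P_first_comm a : a \in P_first k q -> (a * base_inv = base_inv * a)%g.
Proof.
case/setIP; rewrite inE => a_on nA; apply/permP=> x; rewrite !permM.
have aS y : (a y \in first_pts k q) = (y \in first_pts k q) by apply: perm_closed.
have [xf | xf] := boolP (x \in first_pts k q); last first.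
  have lastE y : y \notin first_pts k q -> base_inv y = y.
    by rewrite inE -leqNgt => /base_inv_last.
  by rewrite lastE ?aS // lastE.
have Bx : [set x; base_inv x] \in pairing k q by apply/pairingP; exists x.
have := astabs_act [set x; base_inv x] nA; rewrite Bx => /pairingP[y yf].
rewrite /= setactE /= => /setP By.
have := By (a x); rewrite imset_f ?set21 // => /esym.
have := By (a (base_inv x)); rewrite imset_f ?set22 // => /esym.
have neq : a (base_inv x) != a x.
  rewrite (inj_eq perm_inj); have := pfix_base => /setP/(_ x); rewrite !inE => ->.
  by rewrite -ltnNge; rewrite inE in xf.
rewrite !inE => /orP[] /eqP e1 /orP[] /eqP e2; move: neq; rewrite e1 e2 ?eqxx //.
by rewrite base_invK.
Qed.

Lemma last_comm b : b \in S_last k q -> (b * base_inv = base_inv * b)%g.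
Proof.
rewrite inE => b_on; have t_on : perm_on (first_pts k q) base_inv.
  apply/subsetP=> x; rewrite !inE => tx; rewrite ltnNge; apply: contra tx.
  by move/base_inv_last->.
suff: commute base_inv b by [].
apply: (perm_onC t_on b_on); by rewrite -setI_eq0 first_last setIC setICr.
Qed.

Lemma comm_norm_last c : (c * base_inv = base_inv * c)%g ->
  c \in 'N(last_pts k q | 'P)%g.
Proof. by move/pfix_norm; rewrite pfix_base. Qed.

Lemma norm_last_split c : c \in 'N(last_pts k q | 'P)%g ->
  c = (restr_perm (first_pts k q) c * restr_perm (last_pts k q) c)%g.
Proof.
move=> nl; have nf : c \in 'N(first_pts k q | 'P)%g by rewrite first_last astabsC.
apply/permP=> x; rewrite permM !restr_perm_if //.
have cx : (c x \in last_pts k q) = (x \in last_pts k q).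
  by have /astabsP/(_ x) := nl; rewrite /= apermE.
rewrite first_last !inE; rewrite !inE in cx.
by case: (leqP (2 * k) x) => kx /=; rewrite ?cx ?kx // leqNgt kx.
Qed.

Lemma comm_P_first c : (c * base_inv = base_inv * c)%g ->
  restr_perm (first_pts k q) c \in P_first k q.
Proof.
move=> cc; have nl := comm_norm_last cc.
have nf : c \in 'N(first_pts k q | 'P)%g by rewrite first_last astabsC.
apply/setIP; split; first by rewrite inE restr_perm_on.
rewrite !inE; apply/subsetP=> B /pairingP[x xf ->]; rewrite inE.
have xtf : base_inv x \in first_pts k q by rewrite base_inv_first.
apply/pairingP; exists (c x); first by have /astabsP/(_ x) := nf; rewrite /= apermE => ->.
rewrite /= setactE imsetU1 imset_set1 !['P%act _ _]apermE.
rewrite !restr_perm_if // xf xtf.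
by rewrite -[base_inv (c x)]permM cc permM.
Qed.

(** A permutation commuting with the involution preserves its fixed points, so it splits into its
    restrictions to the last and the first points, and the latter permutes the pairs. *)
Lemma mem_Hkq h : (h \in Hkq k q) = ((h * base_inv)%g == (base_inv * h)%g).
Proof.
apply/idP/eqP => [|cc].
  case/(mem_dprod (Hkq_dprod k q)) => a [b [/P_first_comm aC /last_comm bC -> _]].
  by rewrite -mulgA bC !mulgA aC.
rewrite (norm_last_split (comm_norm_last cc)).
rewrite -(dprodW (Hkq_dprod k q)) mem_mulg ?comm_P_first //.
by rewrite inE restr_perm_on.
Qed.

End BaseInvolution.

(** * Values and admissibility of the row and column characters *)

Section SignLinear.

Variables (T : finType) (G : {group {perm T}}).
Local Open Scope ring_scope.

Lemma sgnE x : sgn G x = (-1) ^+ odd_perm x *+ (x \in G).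
Proof. by rewrite cfunE. Qed.

Lemma sgn_mx_repr : mx_repr G (fun x : {perm T} => ((-1) ^+ odd_perm x)%:M : 'M[algC]_1).
Proof.
by split=> [|x y _ _]; rewrite ?odd_perm1 // odd_permM signr_addb scalar_mxM.
Qed.

Lemma sgn_lin_char : sgn G \is a linear_char.
Proof.
rewrite qualifE /= sgnE group1 odd_perm1 eqxx andbT.
have -> : sgn G = cfRepr (MxRepresentation sgn_mx_repr); last exact: cfRepr_char.
by apply/cfun_inP=> x Gx; rewrite sgnE cfunE Gx /= mxtrace_scalar.
Qed.

End SignLinear.

Section RowCol.

Variables k q : nat.
Local Notation n := (2 * k + q)%N.
Local Open Scope ring_scope.
Local Notation H := (Hkq k q).

Lemma dprod_split h : h \in H ->
  [/\ restr_perm (first_pts k q) h \in P_first k q,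
      restr_perm (last_pts k q) h \in S_last k q &
      h = (restr_perm (first_pts k q) h * restr_perm (last_pts k q) h)%g].
Proof.
rewrite mem_Hkq => /eqP hc; split; first exact: comm_P_first.
  by rewrite inE restr_perm_on.
exact/norm_last_split/comm_norm_last.
Qed.

Lemma lam_rowE h : h \in H -> lam_row k q h = (-1) ^+ restr_perm (last_pts k q) h.
Proof.
move/dprod_split=> [aP bS hE]; rewrite {1}hE cfDprodE // sgnE bS.
by rewrite cfun1E aP mul1r.
Qed.

(** The sign of the restriction to the first points is the sign of h times that of the restriction
    to the last points; thus the column character is the row character times the sign. *)
Lemma lam_colE h : h \in H ->
  lam_col k q h = (-1) ^+ h * (-1) ^+ restr_perm (last_pts k q) h.
Proof.
move/dprod_split=> [aP bS hE]; rewrite {1}hE cfDprodE // cfun1E bS mulr1.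
have sP : P_first k q \subset S_first k q by apply: subsetIl.
rewrite cfResE // sgnE (subsetP sP) // [in RHS]hE odd_permM signr_addb -mulrA.
rewrite -hE.
by rewrite -signr_addb addbb mulr1.
Qed.

Lemma lam_row_lin : lam_row k q \is a linear_char.
Proof. by rewrite cfDprod_lin_char ?cfun1_lin_char ?sgn_lin_char. Qed.

Lemma lam_col_lin : lam_col k q \is a linear_char.
Proof.
rewrite cfDprod_lin_char ?cfun1_lin_char // cfRes_lin_char //; exact: sgn_lin_char.
Qed.

Lemma lam_row2 : {in H, forall h, lam_row k q h ^+ 2 = 1}.
Proof. by move=> h /lam_rowE->; rewrite sqrr_sign. Qed.

Lemma lam_col2 : {in H, forall h, lam_col k q h ^+ 2 = 1}.
Proof. by move=> h /lam_colE->; rewrite exprMn !sqrr_sign mulr1. Qed.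

(** The sign of h is invariant under conjugation and cancels from the comparison. *)
Lemma lam_adm_col : lam_adm [set: 'S_n] (lam_col k q) = lam_adm [set: 'S_n] (lam_row k q).
Proof.
apply/setP=> g; rewrite !inE; apply: eq_forallb_in => h Hh.
case: (boolP (h ^ g \in H)%g) => //= Hhg; rewrite !lam_colE // !lam_rowE // odd_permJ.
by rewrite (inj_eq (mulfI _)) // signr_eq0.
Qed.

(** Put [c = h ^ g]: it commutes with [t0 ^ g] exactly when h lies in H, and its sign on the fixed
    points of [t0 ^ g] is that of h on the fixed points of t0. *)
Lemma lam_adm_row g :
  reflect (sign_match (base_inv k q) (base_inv k q ^ g)%g)
    (g \in lam_adm [set: 'S_n] (lam_row k q)).
Proof.
rewrite inE in_setT /=; apply: (iffP forall_inP) => [gA c ct ctg | gA h Hh].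
  set h := (c ^ g^-1)%g.
  have Hh : h \in H.
    rewrite mem_Hkq; apply/eqP/(@conjg_inj _ g).
    by rewrite [LHS]conjMg [RHS]conjMg /h conjgKV.
  have Hc : c \in H by rewrite mem_Hkq; apply/eqP.
  have := implyP (gA h Hh); rewrite /h conjgKV Hc => /(_ isT)/eqP.
  rewrite !lam_rowE // => /signr_inj e1.
  rewrite pfixJ pfix_base -[in RHS](conjgKV g c) restr_permJ ?odd_permJ -?e1 //.
  by apply: comm_norm_last; apply/eqP; rewrite -mem_Hkq.
apply/implyP=> Hhg; rewrite !lam_rowE //; apply/eqP.
have := gA (h ^ g)%g.
rewrite pfixJ pfix_base restr_permJ ?odd_permJ.
  move=> -> //.
    by apply/eqP; rewrite -mem_Hkq.
  by rewrite -[LHS]conjMg -[RHS]conjMg; congr (_ ^ _)%g; apply/eqP; rewrite -mem_Hkq.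
by apply: comm_norm_last; apply/eqP; rewrite -mem_Hkq.
Qed.

End RowCol.

(** Even blocks have no fixed positions, and a block of size 1 is fixed by both maps. *)
Lemma odd1_blk_fix la k : all (fun m => odd m ==> (m == 1)) la -> k < sumn la ->
  (blk bs la k == k) = (blk bt la k == k).
Proof.
elim: la k => //= m la IH k /andP[m1 la1] klt; case: (ltnP k m) => km.
  by rewrite /bs /bt; do 6?[case: ifP]; lia.
by have := IH (k - m) la1; lia.
Qed.

Lemma blk_fix_odd1 la : 0 \notin la ->
    (forall k, k < sumn la -> (blk bs la k == k) = (blk bt la k == k)) ->
  all (fun m => odd m ==> (m == 1)) la.
Proof.
elim: la => //= m la IH; rewrite inE negb_or => /andP[m0 la0] st.
have mp : 0 < m by lia.
apply/andP; split.
  have := st 0; rewrite ltn_addr // mp /bs /bt /= => /(_ isT).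
  by do 2?[case: ifP]; lia.
apply: IH => // k klt; have := st (m + k); rewrite ltn_add2l => /(_ klt).
by rewrite ltnNge leq_addr /= addKn; lia.
Qed.

(** * The row, column and Young subgroup families *)

Section MainFamilies.

Variables k q : nat.
Local Notation n := (2 * k + q).
Local Notation H := (Hkq k q).
Local Notation t0 := (base_inv k q).

Lemma pfix_odd_parts (la : intpart n) a : t0 = (bS la ^ a)%g -> odd_parts la = q.
Proof.
move=> eS; have := card_last_pts k q; rewrite -pfix_base eS pfixJ.
by rewrite card_imset ?card_pfix_bS //; apply: perm_inj.
Qed.

Lemma odd_parts_conj (la : intpart n) : odd_parts la = q ->
  exists a, t0 = (bS la ^ a)%g.
Proof.
move=> la_q; apply: involution_conj (std_permK _ _ _) (base_inv_sq k q) _.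
by rewrite card_pfix_bS la_q pfix_base card_last_pts.
Qed.

(** The odd parts count the fixed points of the first involution of a standard pair, here q.
    Conversely, for q odd parts, t0 is conjugate to that involution, and the standard pair is
    admissible. *)
Lemma rowcol_gelfand (C : numClosedFieldType) (iota : {rmorphism algC -> C})
    (lam : 'CF(H)) :
    lam \is a linear_char -> {in H, forall h, lam h ^+ 2 = 1}%R ->
    lam_adm [set: 'S_n] lam = lam_adm [set: 'S_n] (lam_row k q) ->
  linear_gelfand_triple [set: 'S_n] lam /\
  twisted_dcalg_iso [set: 'S_n] iota lam (num_odd_parts n q).
Proof.
move=> Llam lam2 admE; apply: (involution_gelfand (t0 := t0)) => //.
- exact: base_inv_sq.
- exact: subsetT.
- exact: mem_Hkq.
- move=> g; rewrite admE => /lam_adm_row; apply: sign_match_path_odd.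
    exact: base_inv_sq.
  exact: involM (base_inv_sq k q) g.
- by move=> g la a _ /pfix_odd_parts la_q _; rewrite inE la_q.
move=> la; rewrite inE => /eqP la_q; have [a eS] := odd_parts_conj la_q.
(* The conjugated reflection serves as g, since it carries the first involution of the pair to the
   second. *)
have eT : (t0 ^ (bZ la ^ a) = bT la ^ a)%g by rewrite eS -conjJg bSJ.
exists (bZ la ^ a)%g; last by exists a.
rewrite admE; apply/lam_adm_row; rewrite eT [t0]eS.
exact/sign_matchJ/std_sign_match.
Qed.

Lemma mem_youngSS g : (g \in youngSS k q) = (g \in 'N(last_pts k q | 'P)%g).
Proof.
apply/idP/idP => [|nl].
  apply/subsetP; rewrite join_subG; apply/andP; split; apply/subsetP=> s.
    rewrite inE => s_on; apply/astabsP=> x; rewrite /= apermE.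
    have := perm_closed x s_on; rewrite first_last !in_setC => /(congr1 negb).
    by rewrite !negbK.
  by rewrite inE => s_on; apply/astabsP=> x; rewrite /= apermE perm_closed.
rewrite (norm_last_split nl) groupM //.
  by apply: (subsetP (joing_subl _ _)); rewrite inE restr_perm_on.
by apply: (subsetP (joing_subr _ _)); rewrite inE restr_perm_on.
Qed.

Lemma sHkq_young : H \subset youngSS k q.
Proof.
by apply/subsetP=> h; rewrite mem_youngSS mem_Hkq => /eqP/comm_norm_last.
Qed.

Lemma young_pfix g : g \in youngSS k q -> pfix (t0 ^ g)%g = last_pts k q.
Proof.
rewrite mem_youngSS pfixJ pfix_base => /astabs_setact {2}<-.
by rewrite /= setactE; apply: eq_imset => x; rewrite /= apermE.
Qed.

(** When the two involutions have the same fixed points, every path component is a single point. *)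
Definition young_types : {set intpart n} :=
  [set la : intpart n | (odd_parts la == q) && all (fun m => odd m ==> (m == 1)) (parts la)].

(** Elements of the Young subgroup preserve the last points, so t0 and [t0 ^ g] have the same fixed
    points, and orbits of these are singletons. *)
Lemma young_gelfand (C : numClosedFieldType) (iota : {rmorphism algC -> C}) :
  gelfand_pair (youngSS k q) H /\
  twisted_dcalg_iso (youngSS k q) iota (1%R : 'CF(H)) #|young_types|.
Proof.
have admG g : g \in lam_adm (youngSS k q) (1%R : 'CF(H)) -> g \in youngSS k q.
  by rewrite inE => /andP[].
apply: (involution_gelfand (t0 := t0)).
- exact: base_inv_sq.
- exact: sHkq_young.
- exact: mem_Hkq.
- exact: cfun1_lin_char.
- by move=> h Hh; rewrite cfun1E Hh expr1n.
- move=> g /admG/young_pfix gfix x fx.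
  have [fx1 fx2] : t0 x = x /\ (t0 ^ g)%g x = x.
    have e1 : (t0 x == x) = (x \in last_pts k q) by rewrite -pfix_base inE.
    have e2 : ((t0 ^ g)%g x == x) = (x \in last_pts k q) by rewrite -gfix inE.
    by split; apply/eqP; move: fx; rewrite e1 e2 orbb.
  by rewrite porbit_fix // permM fx1.
- move=> g la a /admG/young_pfix gfix eS eT; rewrite inE (pfix_odd_parts eS) eqxx.
  apply: blk_fix_odd1; first exact: parts_gt0.
  have eST : pfix (bS la) = pfix (bT la).
    apply: (imset_inj (@perm_inj _ a)).
    by rewrite -!pfixJ -eS -eT gfix pfix_base.
  move=> j jn; have jn' : j < n by rewrite -(sumn_parts la).
  move/setP/(_ (Ordinal jn')): eST.
  by rewrite !inE -!val_eqE /= !std_permE.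
move=> la; rewrite inE => /andP[/eqP la_q la1].
have [a eS] := odd_parts_conj la_q.
have eT : (t0 ^ (bZ la ^ a) = bT la ^ a)%g by rewrite eS -conjJg bSJ.
exists (bZ la ^ a)%g; last by exists a.
have eST : pfix (bS la) = pfix (bT la).
  apply/setP=> j; rewrite !inE -!val_eqE /= !std_permE.
  by apply: odd1_blk_fix; rewrite ?sumn_parts.
rewrite inE mem_youngSS; apply/andP; split; last first.
  apply/forall_inP=> h Hh; apply/implyP=> Hhg.
  by rewrite !cfun1E Hh Hhg.
have lastE : last_pts k q = a @: pfix (bS la) by rewrite -pfixJ -eS pfix_base.
apply/astabsP=> x; rewrite /= apermE lastE -[x](permKV a) permJ.
rewrite !mem_imset; try exact: perm_inj.
set y := (a^-1)%g x; rewrite [in LHS]eST -bSJ pfixJ mem_imset //; exact: perm_inj.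
Qed.

Lemma double_partP (mu : intpart k) : is_intpart n (map double mu ++ nseq q 1).
Proof.
have /and3P[mu_sorted mu0 /eqP mu_sum] := partsP mu.
have geq_trans : transitive geq by move=> a b c ab bc; apply: leq_trans bc ab.
apply/and3P; split.
- rewrite (sorted_pairwise geq_trans) pairwise_cat; apply/and3P; split.
  + apply/allrelP=> x y /mapP[m m_mu ->] /nseqP[-> _].
    have m0 : m != 0 by apply: contraNneq mu0 => <-.
    by rewrite /=; lia.
  + rewrite -(sorted_pairwise geq_trans) sorted_map.
    apply: sub_sorted mu_sorted => x y /=; lia.
  rewrite -(sorted_pairwise geq_trans).
  by case: q => //= q'; elim: q' => //= q' ->.
- rewrite mem_cat negb_or; apply/andP; split.
    apply/mapP=> -[m m_mu m0]; have m00 : m = 0 by lia.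
    by case/negP: mu0; rewrite -m00.
  by apply/nseqP=> -[].
rewrite sumn_cat sumn_nseq mul1n; apply/eqP; congr (_ + _); rewrite -[in RHS]mu_sum.
by elim: (parts mu) => //= m s ->; lia.
Qed.

Definition double_part (mu : intpart k) : intpart n := IntPart (double_partP mu).

Lemma filter_double_part (mu : intpart k) :
  [seq m <- double_part mu | ~~ odd m] = map double mu.
Proof.
rewrite /= filter_cat [X in _ ++ X](_ : _ = [::]) ?cats0; last first.
  by elim: q.
by apply/all_filterP/allP=> m /mapP[m' _ ->]; rewrite odd_double.
Qed.

(** Doubling the parts of a partition of k and appending q ones is a bijection; its inverse halves
    the even parts. *)
Lemma card_young_types : #|young_types| = num_parts k.
Proof.
have inj : injective double_part.
  move=> mu mu' /(congr1 (fun la : intpart n => [seq m <- la | ~~ odd m])).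
  rewrite !filter_double_part => /(inj_map double_inj) e1; exact: val_inj.
rewrite /num_parts -(card_imset predT inj); apply: eq_card => la.
have dbl0 (s : seq nat) : count odd (map double s) = 0.
  by elim: s => //= m s ->; rewrite odd_double.
have odd1_filter (s : seq nat) : all (fun m => odd m ==> (m == 1)) s ->
    [seq m <- s | odd m] = nseq (count odd s) 1.
  elim: s => //= m s IH /andP[m1 s1]; rewrite IH //.
  by case: (odd m) m1 => //= /eqP->.
rewrite inE; apply/andP/imsetP => [[/eqP la_q la1]|[mu _ ->]]; last first.
  rewrite /odd_parts /= count_cat dbl0 count_nseq mul1n eqxx; split=> //.
  rewrite all_cat all_nseq /= orbT andbT.
  by apply/allP=> m /mapP[m' _ ->]; rewrite odd_double.
pose mu_s := [seq m./2 | m <- la & ~~ odd m].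
have dbl_mu : map double mu_s = [seq m <- la | ~~ odd m].
  rewrite -map_comp -[RHS]map_id; apply/eq_in_map => m.
  by rewrite mem_filter /= => /andP[em _]; lia.
have /and3P[la_sorted la0 /eqP la_sum] := partsP la.
have geq_trans : transitive geq by move=> a b c ab bc; apply: leq_trans bc ab.
have perm_la : perm_eq (map double mu_s ++ nseq q 1) la.
  have -> : nseq q 1 = [seq m <- la | odd m].
    by rewrite odd1_filter // -/(odd_parts la) la_q.
  by rewrite dbl_mu perm_catC; apply/permPl/(perm_filterC odd).
have mu_part : is_intpart k mu_s.
  apply/and3P; split.
  - rewrite sorted_map; apply: sub_sorted (sorted_filter geq_trans _ la_sorted).
    by move=> x y /=; lia.
  - apply/mapP=> -[m]; rewrite mem_filter => /andP[em m_la] m0.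
    have m00 : m = 0 by lia.
    by rewrite m00 in m_la; case/negP: la0.
  apply/eqP; have := perm_sumn perm_la; rewrite la_sum sumn_cat sumn_nseq mul1n.
  have -> : sumn (map double mu_s) = 2 * sumn mu_s.
    by elim: mu_s {dbl_mu perm_la} => //= m s ->; lia.
  by lia.
exists (IntPart mu_part) => //; apply: intpart_eqP => m _.
by rewrite /= (seq.permP perm_la).
Qed.

End MainFamilies.

(** * The exceptional models of S_4 *)

Section Young.

Lemma mem_young (n : nat) (c : seq nat) (s : 'S_n) : sumn c = n ->
  (s \in young n c) = [forall i, reshape_index c (s i) == reshape_index c i].
Proof.
move=> c_n; apply/astabP/forallP => [sB i | sP B].
  have i_lt : reshape_index c i < size c by apply: reshape_indexP; rewrite c_n.
  have /sB : [set i0 : 'I_n | reshape_index c i0 == reshape_index c i] \in young_blocks n c.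
    by apply/imsetP; exists (Ordinal i_lt).
  rewrite /= setactE => /setP/(_ (s i)); rewrite [in RHS]inE => <-.
  by apply/imsetP; exists i; rewrite ?inE.
case/imsetP=> j _ ->; rewrite /= setactE; apply/eqP; rewrite eqEcard card_imset ?leqnn.
  rewrite andbT; apply/subsetP=> _ /imsetP[i iB ->].
  by rewrite inE in iB; rewrite inE /= apermE (eqP (sP i)).
exact: act_inj.
Qed.

(** Lists of values turn sums over S_4 into computations on 24 explicit lists. *)
Definition code (s : 'S_4) : seq nat := [seq val (s i) | i <- enum 'I_4].

Lemma nth_code s (i : 'I_4) : nth 0 (code s) i = s i.
Proof. by rewrite (nth_map i) ?size_enum_ord // nth_ord_enum. Qed.

Lemma code_inj : injective code.
Proof.
by move=> s t st; apply/permP=> i; apply: val_inj; rewrite /= -!nth_code st.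
Qed.

Definition codes : seq (seq nat) := permutations (iota 0 4).

Lemma perm_codes : perm_eq [seq code s | s : 'S_4] codes.
Proof.
have Ucode : uniq [seq code s | s : 'S_4] by rewrite map_inj_uniq ?enum_uniq //; apply: code_inj.
have sub : {subset [seq code s | s : 'S_4] <= codes}.
  move=> _ /mapP[s _ ->]; rewrite mem_permutations.
  have Us : uniq (code s).
    rewrite map_inj_uniq ?enum_uniq // => i j /val_inj; exact: perm_inj.
  have sub4 : {subset code s <= iota 0 4}.
    by move=> _ /mapP[i _ ->]; rewrite mem_iota /= ltn_ord.
  have [|_ sE] := uniq_min_size Us sub4; first by rewrite size_map size_enum_ord.
  by apply: uniq_perm; rewrite ?iota_uniq.
have [|_ codesE] := uniq_min_size Ucode sub.
  by rewrite size_map -cardE card_Sn size_permutations ?iota_uniq ?size_iota.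
by apply: uniq_perm; rewrite ?permutations_uniq.
Qed.

Lemma sum_codes (F : seq nat -> algC) :
  (\sum_(s : 'S_4) F (code s) = \sum_(l <- codes) F l)%R.
Proof.
by rewrite -(perm_big _ perm_codes) /= big_map big_enum.
Qed.

(** The parity of the number of inversions. *)
Definition inv_parity (l : seq nat) : bool :=
  odd (sumn [seq count (fun y => y < nth 0 l i) (drop i l) | i <- iota 0 4]).

Definition swapn (a b x : nat) : nat := if x == a then b else if x == b then a else x.

Lemma odd_code s : odd_perm s = inv_parity (code s).
Proof.
have [ts -> ] := prod_tpermP s.
elim/last_ind: ts => [|ts [a b] IH].
  rewrite big_nil odd_perm1 => _.
  have -> : code 1%g = iota 0 4; last by vm_compute.
  by rewrite /code -val_enum_ord; apply: eq_map => i; rewrite perm1.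
rewrite all_rcons => /andP[/= ab dts].
rewrite big_rcons /=.
have codeM u : code (u * tperm a b)%g = map (swapn a b) (code u).
  rewrite -map_comp; apply: eq_map => i; rewrite /= permM.
  case: tpermP => [->|->|ua ub]; rewrite /swapn ?eqxx //; first by case: eqP => [->|].
  by case: eqP => [/val_inj//|_]; case: eqP => [/val_inj//|].
rewrite odd_permM odd_tperm codeM => {codeM}; rewrite IH //; move: (\prod_(t <- ts) _)%g => u.
(* Exchanging two distinct values changes the parity of inversions; this is verified on all 24
   lists. *)
have chk : all (fun l => all (fun a => all (fun b => (a == b) ||
   (inv_parity (map (swapn a b) l) == ~~ inv_parity l)) (iota 0 4)) (iota 0 4)) codes.
  by vm_compute.
have u_codes : code u \in codes by rewrite -(perm_mem perm_codes) image_f.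
have ai (i : 'I_4) : val i \in iota 0 4 by rewrite mem_iota /=.
have := allP (allP (allP chk _ u_codes) _ (ai a)) _ (ai b).
by rewrite val_eqE (negbTE ab) /= addbT => /eqP.
Qed.


Local Notation ri := reshape_index.

Definition young_code (c l : seq nat) : bool :=
  all (fun j => ri c (nth 0 l j) == ri c j) (iota 0 4).

(* [h ^ y] in the Young subgroup, evaluated at the points y j to avoid y^-1. *)
Definition conj_code (c l m : seq nat) : bool :=
  all (fun j => ri c (nth 0 m (nth 0 l j)) == ri c (nth 0 m j)) (iota 0 4).

Lemma all_iota4 (p : pred nat) : all p (iota 0 4) = [forall i : 'I_4, p i].
Proof.
apply/allP/forallP => [pP i | pP j]; first by apply: pP; rewrite mem_iota /=.
by rewrite mem_iota /= => j4; apply: (pP (Ordinal j4)).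
Qed.

Lemma young_codeE c s : sumn c = 4 -> (s \in young 4 c) = young_code c (code s).
Proof.
by move=> c4; rewrite mem_young // /young_code all_iota4; apply: eq_forallb => i; rewrite nth_code.
Qed.

Lemma conj_codeE c (h y : 'S_4) : sumn c = 4 ->
  (h ^ y \in young 4 c)%g = conj_code c (code h) (code y).
Proof.
move=> c4; rewrite mem_young // /conj_code all_iota4.
apply/forallP/forallP => hy i.
  by have := hy (y i); rewrite permJ !nth_code.
by have := hy ((y^-1)%g i); rewrite !nth_code -permJ permKV.
Qed.

Local Open Scope ring_scope.

Definition young_sgn (a : bool) c : 'CF(young 4 c) := if a then sgn _ else 1.

Definition young_ind (a : bool) c : 'CF([set: 'S_4]) := 'Ind (young_sgn a c).

Lemma young_sgn_lin a c : young_sgn a c \is a linear_char.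
Proof. by case: a; [apply: sgn_lin_char | apply: cfun1_lin_char]. Qed.

Lemma young_sgnE a c s :
  young_sgn a c s = (-1) ^+ (a && odd_perm s) *+ (s \in young 4 c).
Proof. by case: a; rewrite /young_sgn /= ?sgnE // cfun1E. Qed.

(** The number of pairs h, y with h of parity [par] in the first Young subgroup and [h ^ y] in the
    second. *)
Definition young_count (par : bool) c c' : nat :=
  sumn [seq count (conj_code c' l) codes |
        l <- codes & young_code c l && (inv_parity l == par)].

Definition young_order c : nat := count (young_code c) codes.

Lemma count_codes (p : pred (seq nat)) :
  (count p codes)%:R = \sum_(s : 'S_4) (p (code s))%:R :> algC.
Proof.
rewrite (sum_codes (fun l => (p l)%:R)).
by elim: codes => [|l s IH]; rewrite ?big_nil // big_cons -IH natrD.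
Qed.

Lemma card_young c : sumn c = 4%N -> #|young 4 c| = young_order c.
Proof.
move=> c4; apply/eqP; rewrite -(eqr_nat algC) count_codes -sum1_card natr_sum.
rewrite big_mkcond; apply/eqP/eq_bigr => s _.
by rewrite -young_codeE //; case: (_ \in _).
Qed.

Lemma sum_signed (I : Type) (s : seq I) (p q : pred I) (f : I -> nat) (e : bool) :
  \sum_(l <- s) (p l * f l)%:R * (-1) ^+ (e && q l) =
  (sumn [seq f l | l <- s & p l && (q l == false)])%:R +
  (-1) ^+ e * (sumn [seq f l | l <- s & p l && (q l == true)])%:R :> algC.
Proof.
elim: s => [|x s IH]; first by rewrite big_nil mulr0 addr0.
rewrite big_cons IH /=; case: (p x) => /=; last by rewrite mul0n mul0r add0r.
case: (q x); rewrite /= ?andbT ?andbF mul1n natrD; last by rewrite mulr1 addrA.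
by rewrite mulrDr [RHS]addrCA [_%:R * _]mulrC.
Qed.

(** Frobenius reciprocity and the formula for induced characters leave a sum over pairs h, y; since
    h and [h ^ y] have equal signs, only the parity of h enters. *)
Lemma cfdot_young a b c c' : sumn c = 4%N -> sumn c' = 4%N ->
  '[young_ind a c, young_ind b c'] =
    (young_order c * young_order c')%:R^-1 *
    ((young_count false c c')%:R + (-1) ^+ (a (+) b) * (young_count true c c')%:R).
Proof.
move=> c4 c4'; rewrite -Frobenius_reciprocity cfdotE card_young //.
rewrite natrM invfM -mulrA; congr (_ * _).
rewrite -(sum_signed _ (young_code c) inv_parity (fun l => count (conj_code c' l) codes)).
pose F l : algC := (young_code c l * count (conj_code c' l) codes)%:R *
  (-1) ^+ ((a (+) b) && inv_parity l).
transitivity ((young_order c')%:R^-1 * \sum_(s : 'S_4) F (code s) : algC); last first.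
  by congr (_ * _); apply: (sum_codes F).
rewrite mulr_sumr /F {F}.
rewrite [RHS](bigID [in young 4 c]) /= [X in _ = _ + X]big1 ?addr0; last first.
  by move=> h hY; rewrite -young_codeE // (negbTE hY) mul0n mul0r mulr0.
apply: eq_bigr => h hY; rewrite cfResE ?subsetT // cfIndE ?subsetT // card_young //.
rewrite -young_codeE // hY mul1n young_sgnE hY mulr1n.
rewrite rmorphM /= fmorphV rmorph_nat mulrCA; congr (_ * _).
rewrite count_codes -odd_code mulr_suml rmorph_sum mulr_sumr; apply: eq_big => [y | y _].
  by rewrite inE.
rewrite /= young_sgnE odd_permJ -conj_codeE //; case: (_ \in _); last first.
  by rewrite mulr0n conjC0 mulr0 mul0r.
rewrite mulr1n rmorph_sign mul1r.
by case: (odd_perm h); case: a; case: b; rewrite /= ?expr0 ?expr1 ?mulrNN ?mul1r ?mulr1.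
Qed.


(** Clearing denominators leaves an equality of natural numbers that can be decided by
    computation. *)
Lemma cfdot_young_same a c c' N :
    sumn c = 4%N -> sumn c' = 4%N -> (0 < young_order c * young_order c')%N ->
    (young_count false c c' + young_count true c c' ==
       N * (young_order c * young_order c'))%N ->
  '[young_ind a c, young_ind a c'] = N%:R.
Proof.
move=> c4 c4' o_gt0 /eqP countE; rewrite cfdot_young // addbb expr0 mul1r -natrD.
move: (young_order c * young_order c')%N o_gt0 countE => o o_gt0 ->.
by rewrite natrM mulrC mulfK // pnatr_eq0 -lt0n.
Qed.

Lemma cfdot_young_diff a c c' N :
    sumn c = 4%N -> sumn c' = 4%N -> (0 < young_order c * young_order c')%N ->
    (young_count false c c' ==
       young_count true c c' + N * (young_order c * young_order c'))%N ->
  '[young_ind a c, young_ind (~~ a) c'] = N%:R.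
Proof.
move=> c4 c4' o_gt0 /eqP countE; rewrite cfdot_young // addbN addbb expr1 mulN1r.
move: (young_order c * young_order c')%N o_gt0 countE => o o_gt0 ->.
by rewrite natrD addrAC subrr add0r natrM mulrC mulfK // pnatr_eq0 -lt0n.
Qed.

End Young.

(** * Irreducibility and multiplicities from norms *)

Section Norms.

Local Open Scope ring_scope.

Variables (gT : finGroupType) (G : {group gT}).

(** A virtual character of norm 1 is irreducible up to sign; its product with the character [chi]
    rules out the minus sign. *)
Lemma irr_of_norm1 (phi chi : 'CF(G)) : phi \in 'Z[irr G] -> '[phi] = 1 ->
  chi \is a character -> '[chi, phi] = 1 -> phi \in irr G.
Proof.
move=> Zphi n1 Cchi; have [[] [i ->]] := vchar_norm1P Zphi n1.
  rewrite scaler_sign cfdotNr => /eqP; rewrite eqr_oppLR => /eqP e1.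
  have := Cnat_cfdot_char_irr i Cchi; rewrite e1 => /natr_ge0.
  by rewrite oppr_ge0 ler10.
by rewrite scaler_sign mem_irr.
Qed.

(** A multiplicity of at least 2 would contribute at least 4 to the norm. *)
Lemma multiplicity_free_norm (phi : 'CF(G)) :
  phi \is a character -> '[phi] <= 3 -> multiplicity_free phi.
Proof.
move=> Cphi n3 i; have /natrP[m e_m] := Cnat_cfdot_char_irr i Cphi.
rewrite e_m (ler_nat _ m 1) leqNgt; apply/negP=> m2.
suff /le_trans/(_ n3) : (4 : algC) <= '[phi] by rewrite ler_nat.
rewrite cfdot_sum_irr (bigD1 i) //= e_m -[4]addr0 lerD //.
  by rewrite rmorph_nat -natrM ler_nat (leq_mul m2 m2).
by apply: sumr_ge0 => j _; apply: mul_conjC_ge0.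
Qed.

(** Each common constituent contributes at least 1 to the inner product. *)
Lemma common_constt_uniq (phi psi : 'CF(G)) i j :
    phi \is a character -> psi \is a character -> '[phi, psi] = 1 ->
    i \in irr_constt phi -> i \in irr_constt psi ->
    j \in irr_constt phi -> j \in irr_constt psi -> i = j.
Proof.
move=> Cphi Cpsi n1 i1 i2 j1 j2; apply/eqP/negP=> /negP ij.
have cge l : l \in irr_constt phi -> l \in irr_constt psi ->
    1 <= '[phi, 'chi_l] * ('[psi, 'chi_l])^*.
  rewrite !irr_consttE; have /natrP[m ->] := Cnat_cfdot_char_irr l Cphi.
  have /natrP[m' ->] := Cnat_cfdot_char_irr l Cpsi; rewrite !pnatr_eq0 rmorph_nat.
  by rewrite -natrM ler1n muln_gt0 !lt0n => -> ->.
have ge0 l : 0 <= '[phi, 'chi_l] * ('[psi, 'chi_l])^*.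
  have /natrP[m ->] := Cnat_cfdot_char_irr l Cphi.
  by have /natrP[m' ->] := Cnat_cfdot_char_irr l Cpsi; rewrite rmorph_nat -natrM ler0n.
have: 1 + 1 <= '[phi, psi].
  rewrite cfdot_sum_irr (bigD1 i) //= (bigD1 j) ?[in X in _ && X]eq_sym //=; last by rewrite eq_sym.
  by rewrite addrA -[1 + 1]addr0 !lerD ?cge ?sumr_ge0.
by rewrite n1 -[X in _ <= X]addr0 lerD2l ler10.
Qed.

End Norms.

(** * The irreducible characters of S_4 in the two models *)

Section SymFour.

Local Open Scope ring_scope.

Local Notation Y := young_ind.

Lemma young_ind_char a c : Y a c \is a character.
Proof. by rewrite cfInd_char ?lin_charW ?young_sgn_lin. Qed.

Lemma chiS_eq (la : intpart 4) (phi : 'CF([set: 'S_4])) :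
    phi \in irr [set: 'S_4] -> '[Y false la, phi] != 0 ->
    '[Y true (conj_parts la), phi] != 0 ->
    '[Y false la, Y true (conj_parts la)] = 1 ->
  chiS la = phi.
Proof.
case/irrP=> j ->; rewrite -!irr_consttE => j1 j2 n1; rewrite /chiS.
case: pickP => [i /andP[i1 i2] | /(_ j)]; last by rewrite j1 j2.
by rewrite (common_constt_uniq _ _ n1 i1 i2 j1 j2) ?young_ind_char.
Qed.

(** By Young's rule, [psi] is the character of (3, 1), or of (2, 1, 1) when a is true; [theta] is
    that of (2, 2) in both cases. *)
Definition psi a := Y a [:: 3; 1] - Y a [:: 4].
Definition theta a := Y a [:: 2; 2] - Y a [:: 3; 1].


Local Notation s4 := [:: 4].
Local Notation s31 := [:: 3; 1].
Local Notation s22 := [:: 2; 2].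
Local Notation s211 := [:: 2; 1; 1].
Local Notation s1111 := [:: 1; 1; 1; 1].

Lemma young_same a :
   '[Y a s4, Y a s4] = 1%:R /\ '[Y a s4, Y a s31] = 1%:R /\
   '[Y a s31, Y a s4] = 1%:R /\ '[Y a s31, Y a s31] = 2%:R /\
   '[Y a s31, Y a s22] = 2%:R /\ '[Y a s22, Y a s31] = 2%:R /\
   '[Y a s22, Y a s22] = 3%:R.
Proof. by do !split; apply: cfdot_young_same; vm_compute. Qed.

Lemma young_diff a :
  '[Y a s4, Y (~~ a) s1111] = 1%:R /\ '[Y a s31, Y (~~ a) s211] = 1%:R /\
   '[Y a s1111, Y (~~ a) s4] = 1%:R /\
   '[Y a s211, Y (~~ a) s4] = 0%:R /\ '[Y a s211, Y (~~ a) s31] = 1%:R /\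
   '[Y a s22, Y (~~ a) s22] = 1%:R /\ '[Y a s22, Y (~~ a) s31] = 0%:R /\
   '[Y a s31, Y (~~ a) s22] = 0%:R /\ '[Y a s31, Y (~~ a) s31] = 0%:R.
Proof. by do !split; apply: cfdot_young_diff; vm_compute. Qed.

Lemma psi_irr a : psi a \in irr [set: 'S_4].
Proof.
have [n44 [n43 [n34 [n33 _]]]] := young_same a.
apply: (irr_of_norm1 (chi := Y a s31)); rewrite ?young_ind_char //.
- by rewrite rpredB ?char_vchar ?young_ind_char.
- by rewrite !(cfdotBl, cfdotBr) n44 n43 n34 n33 subrr subr0 -natrB.
by rewrite cfdotBr n33 n34 -natrB.
Qed.

Lemma theta_irr a : theta a \in irr [set: 'S_4].
Proof.
have [_ [_ [_ [n33 [n32 [n23 n22]]]]]] := young_same a.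
apply: (irr_of_norm1 (chi := Y a s22)); rewrite ?young_ind_char //.
- by rewrite rpredB ?char_vchar ?young_ind_char.
- by rewrite !(cfdotBl, cfdotBr) n33 n32 n23 n22 subrr subr0 -natrB.
by rewrite cfdotBr n22 n23 -natrB.
Qed.

Lemma young4_irr a : Y a s4 \in irr [set: 'S_4].
Proof.
have [n44 _] := young_same a.
by apply: (irr_of_norm1 (chi := Y a s4)); rewrite ?char_vchar ?young_ind_char.
Qed.

Lemma theta_sign : theta true = theta false.
Proof.
have [_ [_ [_ [_ [_ [n1 [n2 [n3 n4]]]]]]]] := young_diff true.
have : '[theta true, theta false] = 1.
  by rewrite !(cfdotBl, cfdotBr) n1 n2 n3 n4 !subr0.
have [/irrP[i ->] /irrP[j ->]] := (theta_irr true, theta_irr false).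
by rewrite cfdot_irr; case: eqP => [-> // | _ /esym/eqP]; rewrite oner_eq0.
Qed.

Lemma chi4_4 : @chi4 s4 isT = Y false s4.
Proof.
have [n44 _] := young_same false; have [d _] := young_diff false.
have [_ [_ [d' _]]] := young_diff true.
by apply: chiS_eq; rewrite ?young4_irr ?n44 ?d' ?d ?oner_eq0.
Qed.

Lemma chi4_31 : @chi4 s31 isT = psi false.
Proof.
have [_ [_ [n34 [n33 _]]]] := young_same false; have [_ [d _]] := young_diff false.
have [_ [_ [_ [d1 [d2 _]]]]] := young_diff true.
apply: chiS_eq; rewrite ?psi_irr //.
  by rewrite cfdotBr n33 n34 -natrB ?oner_eq0.
by rewrite cfdotBr d1 d2 subr0 oner_eq0.
Qed.

Lemma chi4_22 : @chi4 s22 isT = theta false.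
Proof.
have [_ [_ [_ [_ [_ [n23 n22]]]]]] := young_same false.
have [_ [_ [_ [_ [_ [d22 _]]]]]] := young_diff false.
have [_ [_ [_ [_ [_ [d1 [d2 _]]]]]]] := young_diff true.
apply: chiS_eq; rewrite ?theta_irr //.
  by rewrite cfdotBr n22 n23 -natrB ?oner_eq0.
by rewrite cfdotBr d1 d2 subr0 oner_eq0.
Qed.

Lemma chi4_211 : @chi4 s211 isT = psi true.
Proof.
have [_ [_ [n34 [n33 _]]]] := young_same true.
have [_ [_ [_ [d1 [d2 _]]]]] := young_diff false.
apply: chiS_eq; rewrite ?psi_irr //.
  by rewrite cfdotBr d1 d2 subr0 oner_eq0.
by rewrite cfdotBr n33 n34 -natrB ?oner_eq0.
Qed.

Lemma chi4_1111 : @chi4 s1111 isT = Y true s4.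
Proof.
have [n44 _] := young_same true; have [_ [_ [d _]]] := young_diff false.
by apply: chiS_eq; rewrite ?young4_irr ?n44 ?d ?oner_eq0.
Qed.

(** The differences [psi] and [theta] telescope, so each term is induced from the Young subgroup of
    shape (2, 2) or (3, 1). *)
Lemma S4_models_young chi : chi \in S4_model ++ S4_model_transpose ->
  exists a c, chi = Y a c /\ '[chi] <= 3.
Proof.
have sum22 a : Y a s4 + psi a + theta a = Y a s22.
  by rewrite addrC /theta /psi [Y a s4 + _]addrC !subrK.
have sum31 a : psi a + Y a s4 = Y a s31 by rewrite subrK.
have n22 a : '[Y a s22] <= 3.
  by have [_ [_ [_ [_ [_ [_ ->]]]]]] := young_same a; rewrite ler_nat.
have n31 a : '[Y a s31] <= 3.
  by have [_ [_ [_ [-> _]]]] := young_same a; rewrite ler_nat.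
rewrite !inE chi4_4 chi4_31 chi4_22 chi4_211 chi4_1111.
case/or4P=> /eqP->.
- by exists false, s22; rewrite sum22.
- by exists true, s31; rewrite sum31.
- by exists true, s22; rewrite -theta_sign sum22.
by exists false, s31; rewrite sum31.
Qed.

End SymFour.

Local Close Scope nat_scope.
Local Open Scope ring_scope.

Theorem corollary3p2 (C : numClosedFieldType) (iota : {rmorphism algC -> C}) :
  (forall k q : nat,
    let n := (2 * k + q)%N in
    [/\ linear_gelfand_triple [set: 'S_n] (lam_row k q) /\
        linear_gelfand_triple [set: 'S_n] (lam_col k q),
        twisted_dcalg_iso [set: 'S_n] iota (lam_row k q) (num_odd_parts n q) /\
        twisted_dcalg_iso [set: 'S_n] iota (lam_col k q) (num_odd_parts n q)
      & gelfand_pair (youngSS k q) (Hkq k q) /\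
        twisted_dcalg_iso (youngSS k q) iota (1 : 'CF(Hkq k q)) (num_parts k)])
  /\
  (forall chi : 'CF([set: 'S_4]),
     chi \in S4_model ++ S4_model_transpose ->
     (exists (H : {group 'S_4}) (lam : 'CF(H)),
        lam \is a linear_char /\ 'Ind[[set: 'S_4]] lam = chi) /\
     (forall (H : {group 'S_4}) (lam : 'CF(H)),
        lam \is a linear_char -> 'Ind[[set: 'S_4]] lam = chi ->
        linear_gelfand_triple [set: 'S_4] lam)).
Proof.
split=> [k q n | chi /S4_models_young[a [c [-> n3]]]].
  have [rowT rowA] := rowcol_gelfand iota (lam_row_lin k q) (@lam_row2 k q) erefl.
  have [colT colA] :=
    rowcol_gelfand iota (lam_col_lin k q) (@lam_col2 k q) (lam_adm_col k q).
  by have := young_gelfand k q iota; rewrite card_young_types.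
split; first by exists (young 4 c), (young_sgn a c); rewrite young_sgn_lin.
(* Multiplicity-freeness depends only on the induced character, so the norm bound serves every H and
   [lam] inducing it. *)
move=> H lam Llam indE; split; rewrite ?subsetT // indE.
exact: multiplicity_free_norm (young_ind_char a c) n3.
Qed.
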